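(* Let $\alpha$ and $\beta$ be two finite Blaschke products of degree $m>0$ and $n>0$, respectively. Let $\{v_{\eta_1}^{\alpha},\ldots,v_{\eta_m}^{\alpha}\}$ be the Clark basis for $K_{\alpha}$ corresponding to $\lambda_1\in\partial\mathbb{D}$, let $\{v_{\zeta_1}^{\beta},\ldots,v_{\zeta_n}^{\beta}\}$ be the Clark basis for $K_{\beta}$ corresponding to $\lambda_2\in\partial\mathbb{D}$, and assume that the sets $\{\eta_1,\ldots,\eta_m\}$ and $\{\zeta_1,\ldots,\zeta_n\}$ have precisely $l$ elements in common, namely $\eta_j=\zeta_j$ for $j\leq l$ ($l=0$ if there are no elements in common). Let $A$ be any linear transformation from $K_{\alpha}$ into $K_{\beta}$ and let $M_A=(r_{s,p})_{1\le s\le n,\,1\le p\le m}$ be the matrix representation of $A$ with respect to the bases $\{v_{\eta_1}^{\alpha},\ldots,v_{\eta_m}^{\alpha}\}$ and $\{v_{\zeta_1}^{\beta},\ldots,v_{\zeta_n}^{\beta}\}$. (a) If $l=0$, then $A\in\mathscr{T}(\alpha,\beta)$ if and only if $$r_{s,p}=\frac{\sqrt{|\alpha'(\eta_1)|}}{\sqrt{|\alpha'(\eta_p)|}}\frac{\eta_p}{\eta_1}\frac{\eta_1-\zeta_s}{\eta_p-\zeta_s}r_{s,1}+\frac{\sqrt{|\alpha'(\eta_1)|}\sqrt{|\beta'(\zeta_1)|}}{\sqrt{|\alpha'(\eta_p)|}\sqrt{|\beta'(\zeta_s)|}}\frac{\eta_p}{\eta_1}\frac{\zeta_1-\eta_1}{\eta_p-\zeta_s}r_{1,1}+\frac{\sqrt{|\beta'(\zeta_1)|}}{\sqrt{|\beta'(\zeta_s)|}}\frac{\eta_p-\zeta_1}{\eta_p-\zeta_s}r_{1,p}$$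 for all $1\leq p\leq m$ and $1\leq s\leq n$. (b) If $l>0$, then $A\in\mathscr{T}(\alpha,\beta)$ if and only if $$r_{s,p}=\frac{\sqrt{|\alpha'(\eta_s)|}\sqrt{|\beta'(\zeta_1)|}}{\sqrt{|\alpha'(\eta_p)|}\sqrt{|\beta'(\zeta_s)|}}\frac{\eta_p}{\eta_s}\frac{\eta_1-\zeta_s}{\eta_p-\zeta_s}r_{1,s}+\frac{\sqrt{|\beta'(\zeta_1)|}}{\sqrt{|\beta'(\zeta_s)|}}\frac{\eta_p-\zeta_1}{\eta_p-\zeta_s}r_{1,p}$$ for all $p,s$ such that $1\leq p\leq m$, $1\leq s\leq l$, $s\neq p$, and $$r_{s,p}=\frac{\sqrt{|\alpha'(\eta_1)|}}{\sqrt{|\alpha'(\eta_p)|}}\frac{\eta_p}{\eta_1}\frac{\eta_1-\zeta_s}{\eta_p-\zeta_s}r_{s,1}+\frac{\sqrt{|\beta'(\zeta_1)|}}{\sqrt{|\beta'(\zeta_s)|}}\frac{\eta_p-\zeta_1}{\eta_p-\zeta_s}r_{1,p}$$ for all $p,s$ such that $1\leq p\leq m$, $l<s\leq n$.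
   Context: $H^2$ is the classical Hardy space of the unit disk $\mathbb{D}$, identified via boundary values with a closed subspace of $L^2(\partial\mathbb{D})$. The finite Blaschke products are $$\alpha(z)=\prod_{i=1}^{m}\frac{a_i-z}{1-\overline{a}_iz},\qquad \beta(z)=\prod_{j=1}^{n}\frac{b_j-z}{1-\overline{b}_jz},\qquad a_i,b_j\in\mathbb{D},$$ where zeros may be repeated. They are analytic in a neighbourhood of the closed unit disk. The model space of an inner function $\alpha$ is $K_{\alpha}=H^2\ominus\alpha H^2$; $P_{\alpha}$ is the orthogonal projection from $L^2(\partial\mathbb{D})$ onto $K_\alpha$. For $\eta\in\partial\mathbb{D}$ put $k_{\eta}^{\alpha}(z)=\frac{1-\overline{\alpha(\eta)}\alpha(z)}{1-\overline{\eta}z}$, which belongs to $K_\alpha$ and satisfies $\|k_\eta^\alpha\|^2=|\alpha'(\eta)|$; similarly for $\beta$. Clark bases: for $\lambda_1\in\partial\mathbb{D}$ let $\alpha_{\lambda_1}=\frac{\lambda_1+\alpha(0)}{1+\overline{\alpha(0)}\lambda_1}\in\partial\mathbb{D}$. The equation $\alpha(\eta)=\alpha_{\lambda_1}$ has precisely $m$ distinct solutions $\eta_1,\ldots,\eta_m$, all on $\partial\mathbb{D}$, and the functions $v_{\eta_j}^{\alpha}=\|k_{\eta_j}^{\alpha}\|^{-1}k_{\eta_j}^{\alpha}$, $j=1,\ldots,m$, form an orthonormal basis of $K_\alpha$, called the Clark basis corresponding to $\lambda_1$. Likewise for $\lambda_2\in\partial\mathbb{D}$, $\zeta_1,\ldots,\zeta_n\in\partial\mathbb{D}$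 are the $n$ distinct solutions of $\beta(\zeta)=\beta_{\lambda_2}=\frac{\lambda_2+\beta(0)}{1+\overline{\beta(0)}\lambda_2}$, and $v_{\zeta_j}^{\beta}=\|k_{\zeta_j}^{\beta}\|^{-1}k_{\zeta_j}^{\beta}$, $j=1,\ldots,n$, is the Clark basis of $K_\beta$ corresponding to $\lambda_2$. ''Precisely $l$ elements in common'' means that $\{\eta_1,\ldots,\eta_m\}\cap\{\zeta_1,\ldots,\zeta_n\}$ has exactly $l$ elements, indexed so that these are $\eta_j=\zeta_j$, $1\le j\leq l$. The matrix $M_A=(r_{s,p})$ is defined by $Av_{\eta_p}^{\alpha}=\sum_{s=1}^{n}r_{s,p}v_{\zeta_s}^{\beta}$, i.e. $r_{s,p}=\langle Av_{\eta_p}^{\alpha},v_{\zeta_s}^{\beta}\rangle$. For $\varphi\in L^2(\partial\mathbb{D})$ the asymmetric truncated Toeplitz operator $A_{\varphi}^{\alpha,\beta}\colon K_\alpha\to K_\beta$ is $A_{\varphi}^{\alpha,\beta}f=P_{\beta}(\varphi f)$ (functions in the finite-dimensional space $K_\alpha$ are bounded), and $\mathscr{T}(\alpha,\beta)=\{A_{\varphi}^{\alpha,\beta}\colon \varphi\in L^2(\partial\mathbb{D})\text{ and }A_{\varphi}^{\alpha,\beta}\text{ is bounded}\}$. *)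

(* Defs.v *)
From HB Require Import structures.
From mathcomp Require Import all_boot all_order all_algebra.
From mathcomp Require Import all_classical all_reals all_analysis.
From mathcomp Require Import complex.

Set Implicit Arguments.
Unset Strict Implicit.
Unset Printing Implicit Defensive.

Import Order.TTheory GRing.Theory Num.Theory.
Import numFieldNormedType.Exports.

Local Open Scope classical_set_scope.
Local Open Scope ring_scope.

(* Complex functions on the unit circle are represented by functions          *)
(* f : R[i] -> R[i], of which only the values f (cis t) with t in [0, 2 pi]   *)
(* matter. Elements of L^2 are such functions, Borel measurable, up to the    *)
(* relation aeq; no quotient is taken, so linear maps are required to respect *)
(* aeq. The topology and derivatives of R[i] are obtained through R[i]^o.     *)

Section circle.
Variable R : realType.
Local Notation C := R[i].
Implicit Types (f g h : C -> C) (K : set (C -> C)).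

Definition cis (t : R) : C := Complex (cos t) (sin t).

Definition angles : set R := `[0%R, 2 * pi]%classic.

Definition aeq f g : Prop :=
  {ae @lebesgue_measure R, forall t, angles t -> f (cis t) = g (cis t)}.

Definition L2 : set (C -> C) := [set f : C -> C |
  [/\ measurable_fun angles (fun t : R => complex.Re (f (cis t))),
      measurable_fun angles (fun t : R => complex.Im (f (cis t)))
    & (@lebesgue_measure R).-integrable angles
        (fun t : R => (complex.Re (f (cis t)) ^+ 2 +
                   complex.Im (f (cis t)) ^+ 2)%:E)]].

Definition circle_mean f : C :=
  Complex
    ((2 * pi)^-1 * Rintegral (@lebesgue_measure R) angles
                     (fun t : R => complex.Re (f (cis t))))
    ((2 * pi)^-1 * Rintegral (@lebesgue_measure R) angles
                     (fun t : R => complex.Im (f (cis t)))).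

Definition inner f g : C := circle_mean (fun z => f z * (g z)^*).

Definition L2norm f : R := Num.sqrt (complex.Re (inner f f)).

(* Orthogonal projection of L^2 onto K, as the graph relation g |-> h.        *)
Definition is_orthoproj K g h : Prop :=
  [/\ L2 g, K h & forall k, K k -> inner (fun z => g z - h z) k = 0].

(* The Hardy space as a space of functions on the open disk; the values of F  *)
(* outside the disk are irrelevant.                                           *)
Definition hardy_disk (F : C -> C) : Prop :=
  exists2 a : nat -> C,
    cvgn (series (fun k => `|a k| ^+ 2 : C^o)) &
    forall z, `|z| < 1 -> series (fun k => a k * z ^+ k : C^o) @ \oo --> (F z : C^o).

(* The same space inside L^2, through almost everywhere radial limits.        *)
Definition H2 : set (C -> C) := [set f : C -> C | L2 f /\
  exists2 F, hardy_disk F &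
    {ae @lebesgue_measure R, forall t, angles t ->
      (fun r : R => F (r%:C%C * cis t) : C^o) @ 1^'- --> (f (cis t) : C^o)}].

Definition model_space (u : C -> C) : set (C -> C) := [set f : C -> C |
  H2 f /\ forall h, H2 h -> inner f (fun z => u z * h z) = 0].

(* Linear maps between sets of functions taken modulo aeq.                    *)
Record linear_op (K1 K2 : set (C -> C)) (A : (C -> C) -> (C -> C)) : Prop :=
  LinearOp {
    linear_op_maps : forall f, K1 f -> K2 (A f);
    linear_op_aeq : forall f g, K1 f -> K1 g -> aeq f g -> aeq (A f) (A g);
    linear_op_lin : forall (c : C) f g, K1 f -> K1 g ->
      aeq (A (fun z => c * f z + g z)) (fun z => c * A f z + A g z) }.

Definition is_atto (u v phi : C -> C) (A : (C -> C) -> (C -> C)) : Prop :=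
  forall f, model_space u f ->
    is_orthoproj (model_space v) (fun z => phi z * f z) (A f).

Definition bounded_op K (A : (C -> C) -> (C -> C)) : Prop :=
  exists M : R, forall f, K f -> L2norm (A f) <= M * L2norm f.

Definition in_atto (u v : C -> C) (A : (C -> C) -> (C -> C)) : Prop :=
  exists phi, [/\ L2 phi, is_atto u v phi A & bounded_op (model_space u) A].

Definition blaschke (m : nat) (a : 'I_m -> C) (z : C) : C :=
  \prod_(i < m) ((a i - z) / (1 - (a i)^* * z)).

(* At z = eta this is 0 instead of the value of the continuous extension;     *)
(* this does not change the element of L^2.                                   *)
Definition bkernel (u : C -> C) (eta z : C) : C :=
  (1 - (u eta)^* * u z) / (1 - eta^* * z).

Definition clark_vec (u : C -> C) (eta z : C) : C :=
  ((L2norm (bkernel u eta))%:C%C)^-1 * bkernel u eta z.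

Definition clark_value (u : C -> C) (lambda : C) : C :=
  (lambda + u 0) / (1 + (u 0)^* * lambda).

(* For u a Blaschke product of degree m, m distinct solutions of              *)
(* u z = clark_value u lambda are all the solutions.                          *)
Record clark_points (m : nat) (u : C -> C) (lambda : C) (eta : 'I_m -> C) :
    Prop := ClarkPoints {
  clark_inj : injective eta;
  clark_circle : forall j, `|eta j| = 1;
  clark_sol : forall j, u (eta j) = clark_value u lambda }.

Definition is_matrix_of (m n : nat) (A : (C -> C) -> (C -> C))
    (v : 'I_m -> C -> C) (w : 'I_n -> C -> C) (r : 'M[C]_(n, m)) : Prop :=
  forall p, aeq (A (v p)) (fun z => \sum_(s < n) r s p * w s z).

(* sqrt |u'(z)|, for the complex derivative u'.                               *)
Definition sqrt_deriv (u : C -> C) (z : C) : C :=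
  sqrtC `|derive1 (u : C -> C^o) z|.

End circle.

(* Main.v *)
Require Import Defs.
From HB Require Import structures.
From mathcomp Require Import all_boot all_order all_algebra.
From mathcomp Require Import all_classical all_reals all_analysis.
From mathcomp Require Import complex measurable_realfun ring lra.

Set Implicit Arguments.
Unset Strict Implicit.
Unset Printing Implicit Defensive.

Import Order.TTheory GRing.Theory Num.Theory.
Import numFieldNormedType.Exports.

Local Open Scope classical_set_scope.
Local Open Scope ring_scope.

(** Let k_p and l_s be the boundary kernels at the Clark points eta_p and
    zeta_s, and put a0 = alpha (eta_p), b0 = beta (zeta_s); these values do not
    depend on p and s. On the circle k_p conj(l_s) is the fixed function
    (1 - conj(a0) alpha) (1 - b0 conj(beta)) divided by
    (1 - conj(eta_p) z) (1 - zeta_s conj(z)), and partial fractions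
    ([bkernel_split]) write (eta_p - zeta_s) / eta_p * k_p conj(l_s) as a term
    depending on p plus a term depending on s. Integrating against a symbol phi,
    the rescaled entries
      r_(s,p) |alpha'(eta_p)|^(1/2) |beta'(zeta_s)|^(1/2) (eta_p - zeta_s) / eta_p
    of a truncated Toeplitz operator have the form x_p - y_s ([entries_separate],
    [separate_of_atto]). Over any field this is equivalent to the identities of
    the theorem: those express every entry by the first row and the first
    column, with the adjustments forced by the points where eta_p = zeta_s,
    whose rescaled entry vanishes ([entries_disjoint], [entries_common]).

    Conversely, let the rescaled entries be x_p - y_s ([atto_of_separate]). The
    kernels are Lagrange polynomials of the Clark points over the denominator of
    the Blaschke product, so multiplication by a suitable polynomial turns all
    k_p conj(l_s) into z times the polynomials
    U / ((X - eta_p) (X - zeta_s)), up to constants, where U vanishes at all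
    eta_p and all zeta_s ([kernel_product]). The means of a trigonometric
    polynomial against z, z^2, ... are arbitrary, so it suffices to find a linear
    functional on polynomials with prescribed values at these quotients. Such a
    functional is P |-> sum of the residues of P H / U, where H is a Hermite
    interpolation polynomial whose divided differences between the points eta_p
    and zeta_s are the prescribed values ([moment_functional]); the entries at
    common points are free because they prescribe derivatives of H.

    Both directions use that the Clark vectors form an orthonormal basis of the
    model space, with |k_p|^2 = |alpha'(eta_p)|. Elements of the model space are
    polynomials over the denominator of alpha ([model_space_frac]), because
    their product with that denominator has no Fourier coefficients of order at
    least the degree of alpha; Lagrange interpolation then gives spanning.
    Orthogonality is [bkernel_split] with beta = alpha and phi = 1, and the norm
    is read off from the expansion of the reproducing kernel of the origin
    ([bkernel_norm]). The analytic input is that the Fourier coefficients of a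
    boundary function in H^2 are the Taylor coefficients of its extension
    ([energy_tail], [hardy_coef]), proved by Fatou's lemma, and that H^2 is
    closed under multiplication by polynomials and division by 1 - w z for
    |w| < 1. *)

(** * Square-integrable functions on the circle *)

Section CircleFunctions.
Variable R : realType.
Local Notation C := R[i].
Local Notation mu := (@lebesgue_measure R).
Implicit Types (f g h : C -> C) (z w c : C) (t : R).

Definition nrm2 z : R := complex.Re z ^+ 2 + complex.Im z ^+ 2.

Lemma nrm2E z : (nrm2 z)%:C%C = z * z^*.
Proof. by rewrite /nrm2 add_Re2_Im2 normCK. Qed.

Lemma normCE z : `|z| = (Num.sqrt (nrm2 z))%:C%C.
Proof. by rewrite normc_def. Qed.

Lemma nrm2_ge0 z : 0 <= nrm2 z.
Proof. by rewrite addr_ge0 ?sqr_ge0. Qed.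

Lemma nrm2M z w : nrm2 (z * w) = nrm2 z * nrm2 w.
Proof. by apply: complexI; rewrite rmorphM /= !nrm2E rmorphM mulrACA. Qed.

Lemma nrm2J z : nrm2 z^* = nrm2 z.
Proof. by apply: complexI; rewrite !nrm2E conjCK mulrC. Qed.

Lemma nrm2D z w : nrm2 (z + w) <= 2 * nrm2 z + 2 * nrm2 w.
Proof.
case: z w => a b [c d]; rewrite /nrm2 /=.
by have := sqr_ge0 (a - c); have := sqr_ge0 (b - d); nra.
Qed.

Lemma nrm2_eq0 z : (nrm2 z == 0) = (z == 0).
Proof.
by rewrite -(inj_eq (@complexI _)) nrm2E -normCK sqrf_eq0 normr_eq0.
Qed.

Lemma ReM z w : complex.Re (z * w) =
  complex.Re z * complex.Re w - complex.Im z * complex.Im w.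
Proof. by case: z w => a b [c d]. Qed.

Lemma ImM z w : complex.Im (z * w) =
  complex.Re z * complex.Im w + complex.Im z * complex.Re w.
Proof. by case: z w => a b [c d]. Qed.

Lemma ReD z w : complex.Re (z + w) = complex.Re z + complex.Re w.
Proof. by case: z w => a b [c d]. Qed.

Lemma ImD z w : complex.Im (z + w) = complex.Im z + complex.Im w.
Proof. by case: z w => a b [c d]. Qed.

Lemma nrm2_cis t : nrm2 (cis t) = 1.
Proof. by rewrite /nrm2 /= cos2Dsin2. Qed.

Lemma norm_cis t : `|cis t| = 1.
Proof. by rewrite normCE nrm2_cis sqrtr1. Qed.

Lemma measurable_angles : measurable (@angles R : set (measurableTypeR R)).
Proof. exact: measurable_itv. Qed.
Hint Resolve measurable_angles : core.

Lemma angles_finite : (mu (@angles R) < +oo)%E.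
Proof. by rewrite /angles lebesgue_measure_itv /=; case: ifP; rewrite ltry. Qed.

Definition mble f := measurable_fun (@angles R) (fun t => complex.Re (f (cis t))) /\
  measurable_fun (@angles R) (fun t => complex.Im (f (cis t))).

Lemma mble_cst c : mble (fun=> c).
Proof. by split; apply: measurable_cst. Qed.

Lemma mble_id : mble id.
Proof.
split; apply: measurable_funTS; apply: continuous_measurable_fun => t.
- exact: continuous_cos.
- exact: continuous_sin.
Qed.

Lemma mbleD f g : mble f -> mble g -> mble (fun z => f z + g z).
Proof.
move=> [fr fi] [gr gi]; split.
- by under eq_fun do rewrite ReD; apply: measurable_funD.
- by under eq_fun do rewrite ImD; apply: measurable_funD.
Qed.

Lemma mbleM f g : mble f -> mble g -> mble (fun z => f z * g z).
Proof.
move=> [fr fi] [gr gi]; split.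
- by under eq_fun do rewrite ReM; apply: measurable_funB; apply: measurable_funM.
- by under eq_fun do rewrite ImM; apply: measurable_funD; apply: measurable_funM.
Qed.

Lemma mbleJ f : mble f -> mble (fun z => (f z)^*).
Proof.
move=> [fr fi]; split.
- rewrite (_ : (fun _ => _) = (fun t => complex.Re (f (cis t)))) //.
  by apply/funext => t; case: (f _).
- rewrite (_ : (fun _ => _) = (fun t => - complex.Im (f (cis t)))).
    exact: measurable_funN.
  by apply/funext => t; case: (f _).
Qed.

Lemma mbleX n : mble (fun z => z ^+ n).
Proof.
elim: n => [|n IH]; first by under eq_fun do rewrite expr0; apply: mble_cst.
by under eq_fun do rewrite exprS; apply: mbleM => //; apply: mble_id.
Qed.

Lemma measurable_nrm2 f : mble f ->
  measurable_fun (@angles R) (fun t => nrm2 (f (cis t))).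
Proof.
by move=> [fr fi]; apply: measurable_funD; apply: measurable_funX.
Qed.

Lemma L2E f : L2 f <-> mble f /\
  mu.-integrable (@angles R) (fun t => (nrm2 (f (cis t)))%:E).
Proof. by split=> [[? ? ?]|[[? ?] ?]]. Qed.

Lemma L2_mble f : L2 f -> mble f.
Proof. by case/L2E. Qed.

Lemma L2_dom f g (M : R) : mble f ->
  (forall t, nrm2 (f (cis t)) <= M * nrm2 (g (cis t))) -> L2 g -> L2 f.
Proof.
move=> mf le_fg /L2E[mg ig]; apply/L2E; split=> //.
have := @integrableZl _ _ _ mu _ measurable_angles M _ ig.
apply: le_integrable => //; first by apply/measurable_EFinP; exact: (measurable_nrm2 mf).
move=> t _ /=; rewrite lee_fin ger0_norm ?nrm2_ge0 //.
exact: le_trans (ler_norm _).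
Qed.

Lemma L2_cst c : L2 (fun=> c).
Proof.
apply/L2E; split; first exact: mble_cst.
rewrite -/(EFin \o _); apply: measurable_bounded_integrable => //.
- exact: angles_finite.
- exact: bounded_cst.
Qed.

Lemma L2_bounded f (M : R) : mble f -> (forall t, nrm2 (f (cis t)) <= M) ->
  L2 f.
Proof.
move=> mf fM; apply: (@L2_dom _ (fun=> 1) M) => //; last exact: L2_cst.
by move=> t; rewrite /nrm2 /= expr0n expr1n addr0 mulr1; apply: fM.
Qed.

Lemma L2_mulb f g (M : R) : mble f -> (forall t, nrm2 (f (cis t)) <= M) ->
  L2 g -> L2 (fun z => f z * g z).
Proof.
move=> mf fM Lg; apply: (L2_dom _ _ Lg) => [|t].
  by apply: mbleM => //; apply: L2_mble.
by rewrite nrm2M ler_wpM2r ?nrm2_ge0.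
Qed.

Lemma L2D f g : L2 f -> L2 g -> L2 (fun z => f z + g z).
Proof.
move=> /L2E[mf jf] /L2E[mg jg]; apply/L2E; split; first exact: mbleD.
have := integrableD measurable_angles (integrableZl measurable_angles 2 jf)
  (integrableZl measurable_angles 2 jg).
apply: le_integrable => //; first by apply/measurable_EFinP; exact: (measurable_nrm2 (mbleD mf mg)).
move=> t _ /=; rewrite lee_fin ger0_norm ?nrm2_ge0 //.
exact: le_trans (nrm2D _ _) (ler_norm _).
Qed.

Lemma L2Z c f : L2 f -> L2 (fun z => c * f z).
Proof. by apply: (@L2_mulb (fun=> c) f (nrm2 c)) => //; apply: mble_cst. Qed.

Lemma L2B f g : L2 f -> L2 g -> L2 (fun z => f z - g z).
Proof.
move=> Lf Lg; rewrite (_ : (fun _ => _) = fun z => f z + (-1) * g z).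
  by apply: L2D => //; apply: L2Z.
by apply/funext => z; rewrite mulN1r.
Qed.

Lemma L2J f : L2 f -> L2 (fun z => (f z)^*).
Proof.
move=> Lf; apply: (@L2_dom _ f 1) => //; first exact/mbleJ/L2_mble.
by move=> t; rewrite nrm2J mul1r.
Qed.

Lemma L2X n : L2 (fun z => z ^+ n).
Proof.
apply: (@L2_bounded _ 1); first exact: mbleX.
move=> t; elim: n => [|n IH]; first by rewrite /nrm2 /= expr0n expr1n addr0.
by rewrite exprS nrm2M nrm2_cis mul1r.
Qed.

Lemma L2_sum (I : Type) (s : seq I) (F : I -> C -> C) :
  (forall i, L2 (F i)) -> L2 (fun z => \sum_(i <- s) F i z).
Proof.
move=> mF; elim: s => [|i s IH].
  by under eq_fun do rewrite big_nil; apply: L2_cst.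
by under eq_fun do rewrite big_cons; apply: L2D.
Qed.

Lemma L2_horner (p : {poly C}) : L2 (horner p).
Proof.
rewrite (_ : horner p = fun z => \sum_(i < size p) p`_i * z ^+ i); last first.
  by apply/funext => z; rewrite horner_coef.
by apply: L2_sum => i; apply/L2Z/L2X.
Qed.

Lemma L2_eq_circle f g : (forall t, f (cis t) = g (cis t)) -> L2 f -> L2 g.
Proof.
move=> fg [fr fi jf]; split.
- by under eq_fun do rewrite -fg.
- by under eq_fun do rewrite -fg.
- by under eq_fun do rewrite -fg.
Qed.

(** * Integrability and the mean value *)

Definition cintegrable f := mu.-integrable (@angles R)
    (EFin \o (fun t => complex.Re (f (cis t)))) /\
  mu.-integrable (@angles R) (EFin \o (fun t => complex.Im (f (cis t)))).

Lemma cintegrableM f g : L2 f -> L2 g -> cintegrable (fun z => f z * g z).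
Proof.
move=> /L2E[mf jf] /L2E[mg jg].
have [mr mi] := mbleM mf mg.
have jfg := integrableD measurable_angles jf jg.
split; apply: le_integrable jfg => //; first [exact/measurable_EFinP | move=> t _ /=];
  rewrite lee_fin [leRHS]ger0_norm ?(addr_ge0 (nrm2_ge0 _) (nrm2_ge0 _)) //;
  case: (f (cis t)) (g (cis t)) => a b [c d]; rewrite /nrm2 /=; rewrite ler_norml;
  have ? := sqr_ge0 (a - c); have ? := sqr_ge0 (a + c); have ? := sqr_ge0 (b - d);
  have ? := sqr_ge0 (b + d); have ? := sqr_ge0 (a - d); have ? := sqr_ge0 (a + d);
  have ? := sqr_ge0 (b - c); have ? := sqr_ge0 (b + c);
  by apply/andP; split; nra.
Qed.

Lemma cintegrable_L2 f : L2 f -> cintegrable f.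
Proof.
move=> Lf; have := cintegrableM Lf (L2_cst 1).
by under eq_fun do rewrite mulr1.
Qed.

Lemma integrable_angles_Z (x : R) (p : R -> R) :
  mu.-integrable (@angles R) (EFin \o p) ->
  mu.-integrable (@angles R) (EFin \o (fun t => x * p t)).
Proof. by move=> ip; apply: eq_integrable (integrableZl _ x ip). Qed.

Lemma integrable_angles_D (p q : R -> R) :
  mu.-integrable (@angles R) (EFin \o p) ->
  mu.-integrable (@angles R) (EFin \o q) ->
  mu.-integrable (@angles R) (EFin \o (fun t => p t + q t)).
Proof. by move=> ip iq; apply: eq_integrable (integrableD _ ip iq). Qed.

Lemma cintegrableZ c f : cintegrable f -> cintegrable (fun z => c * f z).
Proof.
case: c => a b [fr fi]; split.
- rewrite (_ : (fun _ => _) = (fun t => a * complex.Re (f (cis t))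
    + (- b) * complex.Im (f (cis t)))).
    by apply: integrable_angles_D; apply: integrable_angles_Z.
  by apply/funext => t; rewrite ReM /= mulNr.
- rewrite (_ : (fun _ => _) = (fun t => a * complex.Im (f (cis t))
    + b * complex.Re (f (cis t)))).
    by apply: integrable_angles_D; apply: integrable_angles_Z.
  by apply/funext => t; rewrite ImM.
Qed.

Lemma cintegrableD f g : cintegrable f -> cintegrable g ->
  cintegrable (fun z => f z + g z).
Proof.
move=> [fr fi] [gr gi]; split.
- rewrite (_ : (fun _ => _) = (fun t => complex.Re (f (cis t)) +
    complex.Re (g (cis t)))); first exact: integrable_angles_D.
  by apply/funext => t; rewrite ReD.
- rewrite (_ : (fun _ => _) = (fun t => complex.Im (f (cis t)) +
    complex.Im (g (cis t)))); first exact: integrable_angles_D.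
  by apply/funext => t; rewrite ImD.
Qed.

Lemma mean_lin c f g : cintegrable f -> cintegrable g ->
  circle_mean (fun z => c * f z + g z) = c * circle_mean f + circle_mean g.
Proof.
move=> [fr fi] [gr gi]; case: c => a b.
rewrite /circle_mean.
have -> : (fun t => complex.Re (Complex a b * f (cis t) + g (cis t))) =
   (fun t => (a * complex.Re (f (cis t)) + (- b) * complex.Im (f (cis t)))
     + complex.Re (g (cis t))).
  by apply/funext => t; rewrite ReD ReM /= mulNr.
have -> : (fun t => complex.Im (Complex a b * f (cis t) + g (cis t))) =
   (fun t => (a * complex.Im (f (cis t)) + b * complex.Re (f (cis t)))
     + complex.Im (g (cis t))).
  by apply/funext => t; rewrite ImD ImM.
rewrite !RintegralD ?RintegralZl //; try by do ?[apply: integrable_angles_D|apply: integrable_angles_Z].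
by apply/eqP; rewrite eq_complex /=; apply/andP; split; apply/eqP; ring.
Qed.

End CircleFunctions.
#[global] Hint Resolve measurable_angles : core.

Section MeanValue.
Variable R : realType.
Local Notation C := R[i].
Local Notation mu := (@lebesgue_measure R).
Implicit Types (f g h : C -> C) (z w c : C) (t : R).

Lemma mean_eq_circle f g : (forall t, f (cis t) = g (cis t)) ->
  circle_mean f = circle_mean g.
Proof.
move=> fg; rewrite /circle_mean.
by congr (Complex (_ * _) (_ * _)); apply: eq_Rintegral => t _; rewrite fg.
Qed.

Lemma Rintegral_angles0 : Rintegral mu (@angles R) (fun=> 0) = 0.
Proof. by rewrite Rintegral_cst // mul0r. Qed.

Lemma mean0 : circle_mean (fun=> 0 : C) = 0.
Proof. by rewrite /circle_mean /= Rintegral_angles0 mulr0. Qed.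

Lemma mean_scale c f : cintegrable f ->
  circle_mean (fun z => c * f z) = c * circle_mean f.
Proof.
move=> jf; have := mean_lin c jf (cintegrable_L2 (L2_cst 0)).
by rewrite mean0 addr0 => <-; apply: mean_eq_circle => t; rewrite addr0.
Qed.

Lemma meanZ c f : L2 f -> circle_mean (fun z => c * f z) = c * circle_mean f.
Proof. by move=> /cintegrable_L2; apply: mean_scale. Qed.

Lemma meanD f g : L2 f -> L2 g ->
  circle_mean (fun z => f z + g z) = circle_mean f + circle_mean g.
Proof.
move=> Lf Lg.
have := mean_lin 1 (cintegrable_L2 Lf) (cintegrable_L2 Lg).
by rewrite mul1r => <-; apply: mean_eq_circle => t; rewrite mul1r.
Qed.

Lemma mean_sum (I : Type) (s : seq I) (F : I -> C -> C) :
  (forall i, L2 (F i)) ->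
  circle_mean (fun z => \sum_(i <- s) F i z) = \sum_(i <- s) circle_mean (F i).
Proof.
move=> LF; elim: s => [|i s IH].
  by rewrite big_nil -[RHS]mean0; apply: mean_eq_circle => t; rewrite big_nil.
rewrite big_cons -IH -meanD //; last exact: L2_sum.
by apply: mean_eq_circle => t; rewrite big_cons.
Qed.

Lemma meanJ f : L2 f -> circle_mean (fun z => (f z)^*) = (circle_mean f)^*.
Proof.
move=> /cintegrable_L2[_ fi]; rewrite /circle_mean -[RHS]/(Complex _ (- _)).
congr (Complex (_ * _) _); first by apply: eq_Rintegral => t _; case: (f (cis t)) => a b.
rewrite -[in RHS]mulrN; congr (_ * _).
rewrite -mulN1r -RintegralZl //; apply: eq_Rintegral => t _.
by rewrite mulN1r; case: (f (cis t)) => a b.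
Qed.

Lemma inner_linl c f g h : L2 f -> L2 g -> L2 h ->
  inner (fun z => c * f z + g z) h = c * inner f h + inner g h.
Proof.
move=> Lf Lg Lh; rewrite /inner -mean_lin; try exact: cintegrableM (L2J Lh).
by apply: mean_eq_circle => t; rewrite mulrDl mulrA.
Qed.

Lemma innerJ f g : L2 f -> L2 g -> inner g f = (inner f g)^*.
Proof.
move=> Lf Lg; have [fr fi] := cintegrableM Lf (L2J Lg).
rewrite /inner /circle_mean -[RHS]/(Complex _ (- _)); congr (Complex (_ * _) _).
  apply: eq_Rintegral => t _.
  by case: (f (cis t)) (g (cis t)) => a b [c d] /=; ring.
rewrite -[in RHS]mulrN; congr (_ * _).
rewrite -mulN1r -RintegralZl //; apply: eq_Rintegral => t _.
by case: (f (cis t)) (g (cis t)) => a b [c d] /=; ring.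
Qed.

Lemma innerZl c f h : L2 f -> L2 h -> inner (fun z => c * f z) h = c * inner f h.
Proof.
move=> Lf Lh; have := inner_linl c Lf (L2_cst 0) Lh.
have -> : inner (fun=> 0) h = 0.
  by rewrite -[RHS]mean0; apply: mean_eq_circle => t; rewrite mul0r.
by rewrite addr0 => <-; apply: mean_eq_circle => t; rewrite addr0.
Qed.

Lemma innerBl f g h : L2 f -> L2 g -> L2 h ->
  inner (fun z => f z - g z) h = inner f h - inner g h.
Proof.
move=> Lf Lg Lh; rewrite addrC -mulN1r -inner_linl //.
by apply: mean_eq_circle => t; rewrite mulN1r addrC.
Qed.

Lemma inner_suml (I : Type) (s : seq I) (c : I -> C) (F : I -> C -> C) h :
  (forall i, L2 (F i)) -> L2 h ->
  inner (fun z => \sum_(i <- s) c i * F i z) h = \sum_(i <- s) c i * inner (F i) h.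
Proof.
move=> LF Lh; elim: s => [|i s IH].
  by rewrite big_nil -[RHS]mean0; apply: mean_eq_circle => t; rewrite big_nil mul0r.
rewrite big_cons -IH -inner_linl //; last by apply: L2_sum => j; apply: L2Z.
by apply: mean_eq_circle => t; rewrite big_cons.
Qed.

Lemma inner_sumr (I : Type) (s : seq I) (c : I -> C) (F : I -> C -> C) h :
  (forall i, L2 (F i)) -> L2 h ->
  inner h (fun z => \sum_(i <- s) c i * F i z) =
  \sum_(i <- s) (c i)^* * inner h (F i).
Proof.
move=> LF Lh; rewrite (innerJ _ Lh); last by apply: L2_sum => i; apply: L2Z.
rewrite inner_suml // rmorph_sum; apply: eq_bigr => i _.
by rewrite rmorphM /= -innerJ.
Qed.

Lemma innerff f : inner f f =
  ((2 * pi)^-1 * Rintegral mu (@angles R) (fun t => nrm2 (f (cis t))))%:C%C.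
Proof.
rewrite /inner /circle_mean; congr (Complex _ _).
  congr (_ * _); apply: eq_Rintegral => t _.
  by case: (f (cis t)) => a b; rewrite /nrm2 /=; ring.
rewrite (_ : Rintegral _ _ _ = 0) ?mulr0 // -[RHS]Rintegral_angles0.
by apply: eq_Rintegral => t _; case: (f (cis t)) => a b /=; ring.
Qed.

Lemma innerff_ge0 f : 0 <= inner f f.
Proof.
rewrite innerff ler0c mulr_ge0 ?invr_ge0 ?mulr_ge0 ?pi_ge0 //.
by apply: Rintegral_ge0 => t _; apply: nrm2_ge0.
Qed.

Lemma L2normE f : ((L2norm f)%:C%C) ^+ 2 = inner f f.
Proof.
have := innerff_ge0 f; rewrite /L2norm innerff ler0c => h.
by rewrite -rmorphXn sqr_sqrtr.
Qed.

(** Expand the squared norm of f - (f, g) g. *)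
Lemma bessel f g : L2 f -> L2 g -> inner g g = 1 ->
  `|inner f g| ^+ 2 <= inner f f.
Proof.
move=> Lf Lg gg1; set c := inner f g.
pose h := fun z => (- c) * g z + f z.
have Lh : L2 h by apply: L2D => //; apply: L2Z.
have hh : inner h h = inner f f - c * c^*.
  have hg : inner h g = 0 by rewrite inner_linl // gg1 mulr1 addNr.
  have hf : inner h f = inner f f - c * c^*.
    by rewrite inner_linl // (innerJ Lf Lg) -/c mulNr addrC.
  rewrite {1}/h inner_linl // (innerJ Lh Lg) hg rmorph0 mulr0 add0r.
  by rewrite (innerJ Lh Lf) hf rmorphB rmorphM /= conjCK -innerJ // [c^* * c]mulrC.
by rewrite normCK -subr_ge0 -hh innerff_ge0.
Qed.

(** * Characters of the circle *)

Lemma cisX t n : cis t ^+ n = cis (n%:R * t).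
Proof.
elim: n => [|n IH]; first by rewrite expr0 mul0r /cis cos0 sin0.
rewrite exprS IH -addn1 natrD mulrDl mul1r [n%:R * t + t]addrC /cis cosD sinD.
by apply/eqP; rewrite eq_complex /=; apply/andP; split; apply/eqP; ring.
Qed.

Lemma cis2pi : cis (2 * pi : R) = 1.
Proof. by rewrite /cis mulr_natl cos2pi sin2pi. Qed.

Lemma pi2_gt0 : 0 < 2 * pi :> R.
Proof. by rewrite mulr_gt0 ?pi_gt0. Qed.

Lemma FTC2_angles (f F : R -> R) : continuous f ->
  (forall t, is_derive t (1 : R) F (f t)) ->
  Rintegral mu (@angles R) f = F (2 * pi) - F 0.
Proof.
move=> cf dF; rewrite /Rintegral /angles.
rewrite (@continuous_FTC2 _ f F) ?pi2_gt0 //.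
- exact: continuous_subspaceT.
- have cF t : {for t, continuous F}.
    by apply: differentiable_continuous; apply/derivable1_diffP; case: (dF t).
  split=> [t _||]; first by case: (dF t).
  + exact/cvg_at_right_filter/cF.
  + exact/cvg_at_left_filter/cF.
- by move=> t _; rewrite derive1E; case: (dF t).
Qed.

Lemma meanX n : circle_mean (fun z : C => z ^+ n.+1) = 0.
Proof.
set k : R := n.+1%:R.
have k0 : k != 0 by rewrite pnatr_eq0.
have dl t : is_derive t (1 : R) ( *%R k) k.
  rewrite -[X in is_derive _ _ X _]/(k \*: (id : R -> R)).
  by apply: is_derive_eq; rewrite /GRing.scale /= mulr1.
have ckt : continuous (fun t => k * t) by move=> t; apply: mulrl_continuous.
have E t : cis t ^+ n.+1 = Complex (cos (k * t)) (sin (k * t)) by rewrite cisX.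
have [ck sk] : cos (k * (2 * pi)) = 1 /\ sin (k * (2 * pi)) = 0.
  have /eqP := E (2 * pi); rewrite cis2pi expr1n eq_complex /=.
  by move=> /andP[/eqP <- /eqP <-].
rewrite /circle_mean; apply/eqP; rewrite eq_complex /= !mulf_eq0.
apply/andP; split; apply/orP; right; apply/eqP.
- under eq_fun do rewrite E /=.
  apply: (etrans (@FTC2_angles _ (fun t => k^-1 * sin (k * t)) _ _)).
  + by move=> t; apply: continuous_comp; [exact: ckt | exact: continuous_cos].
  + move=> t.
    have d1 := is_derive1_comp (is_derive_sin (k * t)) (dl t).
    rewrite -[X in is_derive _ _ X _]/(k^-1 \*: (sin \o *%R k)).
    by apply: is_derive_eq; rewrite /GRing.scale /=; field.
  + by rewrite sk !mulr0 sin0 mulr0 subrr.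
- under eq_fun do rewrite E /=.
  apply: (etrans (@FTC2_angles _ (fun t => - k^-1 * cos (k * t)) _ _)).
  + by move=> t; apply: continuous_comp; [exact: ckt | exact: continuous_sin].
  + move=> t.
    have d1 := is_derive1_comp (is_derive_cos (k * t)) (dl t).
    rewrite -[X in is_derive _ _ X _]/((- k^-1) \*: (cos \o *%R k)).
    by apply: is_derive_eq; rewrite /GRing.scale /=; field.
  + by rewrite ck mulr0 cos0 subrr.
Qed.

Lemma mu_angles : mu (@angles R) = (2 * pi)%:E.
Proof. by rewrite /angles lebesgue_measure_itv /= lte_fin pi2_gt0 -EFinD subr0. Qed.

Lemma mean_cst c : circle_mean (fun=> c) = c.
Proof.
have E x : Rintegral mu (@angles R) (fun=> x) = x * (2 * pi).
  by rewrite Rintegral_cst //; congr (x * _); apply: (congr1 fine mu_angles).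
case: c => a b; rewrite /circle_mean /= !E ![_ * (2 * pi)]mulrC.
by rewrite !mulKf // gt_eqF // pi2_gt0.
Qed.

Lemma cis_mulJ t : cis t * (cis t)^* = 1.
Proof. by rewrite -nrm2E nrm2_cis. Qed.

Lemma innerX n k : inner (fun z : C => z ^+ n) (fun z => z ^+ k) = (n == k)%:R.
Proof.
wlog le_kn : n k / (k <= n)%N => [wl|].
  have /orP[kn|nk] := leq_total k n; first exact: wl.
  rewrite (innerJ (L2X _ k) (L2X _ n)) wl // conjC_nat.
  by rewrite eq_sym.
transitivity (circle_mean (fun z : C => z ^+ (n - k))).
  apply: mean_eq_circle => t; rewrite -{1}(subnK le_kn) exprD rmorphXn -mulrA.
  by rewrite -exprMn cis_mulJ expr1n mulr1.
have [->|ne] := eqVneq n k.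
  by rewrite subnn -[RHS](mean_cst 1); apply: mean_eq_circle => t; rewrite expr0.
rewrite [RHS]mulr0n -(meanX (n - k).-1) prednK // subn_gt0 ltn_neqAle le_kn andbT eq_sym.
by [].
Qed.

End MeanValue.

(** * Convergence in the complex plane *)

Section ComplexConvergence.
Variable R : realType.
Local Notation C := R[i].
Implicit Types (z w c : C).

Lemma Re_le_norm z : `|complex.Re z|%:C%C <= `|z|.
Proof. exact: normc_ge_Re. Qed.

Lemma Im_le_norm z : `|complex.Im z|%:C%C <= `|z|.
Proof.
rewrite normCE lecR -sqrtr_sqr ler_sqrt ?nrm2_ge0 //.
by rewrite /nrm2 lerDr sqr_ge0.
Qed.

Lemma norm_le_ReIm z : `|z| <= (`|complex.Re z| + `|complex.Im z|)%:C%C.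
Proof.
rewrite normCE lecR -[leRHS]ger0_norm ?addr_ge0 // -sqrtr_sqr ler_sqrt ?sqr_ge0 //.
rewrite sqrrD !real_normK ?num_real // /nrm2.
by rewrite -addrA [X in _ <= _ + X]addrC addrA lerDl mulrn_wge0 // mulr_ge0.
Qed.

Lemma gt0C (e : C) : 0 < e -> exists2 r : R, 0 < r & e = r%:C%C.
Proof.
case: e => a b; rewrite ltcE /= => /andP[/eqP-> a0]; by exists a.
Qed.

Section Filters.
Variables (T : Type) (F : set_system T).
Context {FF : Filter F}.

Lemma cvg_complexP (f : T -> C) (l : C) :
  ((f x : C^o) @[x --> F] --> (l : C^o)) <->
  (complex.Re (f x) @[x --> F] --> complex.Re l) /\
  (complex.Im (f x) @[x --> F] --> complex.Im l).
Proof.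
split=> [/cvgrPdist_lt fl|[/cvgrPdist_lt rl /cvgrPdist_lt il]].
  split; apply/cvgrPdist_lt => e e0.
    have := fl e%:C%C; rewrite ltcR => /(_ e0); apply: filterS => x.
    move=> /(le_lt_trans (Re_le_norm _)); rewrite ltcR.
    by case: l (f x) {fl} => a b [c d].
  have := fl e%:C%C; rewrite ltcR => /(_ e0); apply: filterS => x.
  move=> /(le_lt_trans (Im_le_norm _)); rewrite ltcR.
  by case: l (f x) {fl} => a b [c d].
apply/cvgrPdist_lt => e /gt0C[r r0 ->].
have r20 : 0 < r / 2 by rewrite divr_gt0.
apply: filterS2 (rl _ r20) (il _ r20) => x h1 h2.
apply: le_lt_trans (norm_le_ReIm _) _; rewrite ltcR (splitr r).
by apply: ltrD; move: h1 h2; case: l {rl il} (f x) => a b [c d].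
Qed.

Lemma cvg_nrm2 (f : T -> C) (l : C) : (f x : C^o) @[x --> F] --> (l : C^o) ->
  nrm2 (f x) @[x --> F] --> nrm2 l.
Proof.
move=> /cvg_complexP[rl il]; rewrite /nrm2.
have sq (u : T -> R) (v : R) : u x @[x --> F] --> v -> u x ^+ 2 @[x --> F] --> v ^+ 2.
  by move=> uv; rewrite expr2; under eq_fun do rewrite expr2; apply: cvgM.
by apply: cvgD; apply: sq.
Qed.

End Filters.

Lemma cvg_horner (T : Type) (F : set_system T) {FF : Filter F} (p : {poly C})
    (f : T -> C) (l : C) :
  (f x : C^o) @[x --> F] --> (l : C^o) ->
  (p.[f x] : C^o) @[x --> F] --> (p.[l] : C^o).
Proof.
move=> fl; elim/poly_ind: p => [|p c IH].
  by rewrite horner0; under eq_fun do rewrite horner0; apply: cvg_cst.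
rewrite hornerMXaddC; under eq_fun do rewrite hornerMXaddC.
have h1 := @cvgM C T F FF (fun x => p.[f x]) f p.[l] l IH fl.
exact: (@cvgD C C^o T F FF (fun x => p.[f x] * f x) (fun=> c) _ _ h1 (cvg_cst _)).
Qed.

End ComplexConvergence.

(** * Equality almost everywhere *)

Section AlmostEverywhere.
Variable R : realType.
Local Notation C := R[i].
Local Notation mu := (@lebesgue_measure R).
Implicit Types (f g h : C -> C) (z w c : C) (t : R).

Lemma ae_imp (P Q : R -> Prop) : (forall t, P t -> Q t) ->
  {ae mu, forall t, P t} -> {ae mu, forall t, Q t}.
Proof. by move=> PQ; apply: negligibleS => t /= nQ /PQ. Qed.

Lemma ae_imp2 (P Q S : R -> Prop) : (forall t, P t -> Q t -> S t) ->
  {ae mu, forall t, P t} -> {ae mu, forall t, Q t} -> {ae mu, forall t, S t}.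
Proof.
move=> PQS nP nQ; apply: negligibleS (negligibleU nP nQ) => t /= nS.
by have [Pt|] := pselect (P t); [right => Qt; apply/nS/PQS | left].
Qed.

Lemma aeq_circle f g : (forall t, f (cis t) = g (cis t)) -> aeq f g.
Proof. by move=> fg; apply: aeW => t _. Qed.

Lemma aeq_refl f : aeq f f.
Proof. exact: aeq_circle. Qed.

Lemma aeq_sym f g : aeq f g -> aeq g f.
Proof. by apply: ae_imp => t h /h. Qed.

Lemma aeq_trans f g h : aeq f g -> aeq g h -> aeq f h.
Proof. by apply: ae_imp2 => t h1 h2 tA; rewrite h1 // h2. Qed.

Lemma aeq_op2 (op : C -> C -> C -> C) f g f' g' : aeq f f' -> aeq g g' ->
  aeq (fun z => op z (f z) (g z)) (fun z => op z (f' z) (g' z)).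
Proof. by apply: ae_imp2 => t h1 h2 tA; rewrite h1 // h2. Qed.

Lemma aeq_op1 (op : C -> C -> C) f f' : aeq f f' ->
  aeq (fun z => op z (f z)) (fun z => op z (f' z)).
Proof. by apply: ae_imp => t h1 tA; rewrite h1. Qed.

Lemma aeq_sum (I : Type) (s : seq I) (F G : I -> C -> C) :
  (forall i, aeq (F i) (G i)) ->
  aeq (fun z => \sum_(i <- s) F i z) (fun z => \sum_(i <- s) G i z).
Proof.
move=> FG; elim: s => [|i s IH]; first by apply: aeq_circle => t; rewrite !big_nil.
apply: ae_imp2 (FG i) IH => t h1 h2 tA.
by rewrite !big_cons h1 // h2.
Qed.

(** The cosine is injective on [0, pi] and, by reflection, on [pi, 2 pi], so a
    point of the circle has at most two angles. *)
Lemma negligible_cis w : mu.-negligible [set t | angles t /\ cis t = w].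
Proof.
have neg1 (A : set R) : is_subset1 A -> mu.-negligible A.
  move=> A1; have [[t At]|nA] := pselect (exists t, A t).
    have n1 : mu.-negligible [set t].
      by apply/negligibleP; [exact: measurable_set1 | exact: lebesgue_measure_set1].
    by apply: negligibleS n1 => u Au; apply: A1.
  have -> : A = set0 by apply/seteqP; split=> // u Au; case: nA; exists u.
  exact: negligible_set0.
have n1 : mu.-negligible [set t | t \in `[0, pi] /\ cos t = complex.Re w].
  by apply: neg1 => t u [t1 t2] [u1 u2]; apply: cos_inj => //; rewrite t2.
have n2 : mu.-negligible
    [set t | 2 * pi - t \in `[0, pi] /\ cos (2 * pi - t) = complex.Re w].
  apply: neg1 => t u [t1 t2] [u1 u2].
  have := cos_inj t1 u1; rewrite t2 u2 => /(_ erefl) /addrI.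
  exact: oppr_inj.
apply: negligibleS (negligibleU n1 n2) => t [/=].
rewrite /angles /= in_itv /= => /andP[t0 t2] <-.
have [tp|pt] := leP t pi; [left|right]; rewrite /= in_itv /=; split => //.
- by rewrite t0.
- by apply/andP; split; lra.
- by rewrite mulr_natl cosB cos2pi sin2pi mul1r mul0r addr0.
Qed.

(** A boundary kernel takes the value 0 at its own point instead of its limit,
    so identities between kernels only hold off finitely many points. *)
Lemma aeq_off (s : seq C) f g :
  (forall t, cis t \notin s -> f (cis t) = g (cis t)) -> aeq f g.
Proof.
move=> fg.
have : {ae mu, forall t, angles t -> cis t \notin s}.
  elim: s {fg} => [|w s IH]; first exact: aeW.
  have hw : {ae mu, forall t, angles t -> cis t != w}.
    apply: negligibleS (negligible_cis w) => t /= /not_implyP[tA].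
    by move=> /negP/negPn/eqP.
  apply: ae_imp2 hw IH => t h1 h2 tA.
  by rewrite inE negb_or h1 // h2.
by apply: ae_imp => t h tA; apply: fg; apply: h.
Qed.

Lemma mean_aeq f g : cintegrable f -> cintegrable g -> aeq f g ->
  circle_mean f = circle_mean g.
Proof.
move=> [fr fi] [gr gi] fg; rewrite /circle_mean /Rintegral.
congr (Complex (_ * fine _) (_ * fine _)); apply: ae_eq_integral => //.
- exact: measurable_int fr.
- exact: measurable_int gr.
- by apply: ae_imp fg => t h tA; rewrite h.
- exact: measurable_int fi.
- exact: measurable_int gi.
- by apply: ae_imp fg => t h tA; rewrite h.
Qed.

Lemma inner_aeq f f' g g' : L2 f -> L2 f' -> L2 g -> L2 g' ->
  aeq f f' -> aeq g g' -> inner f g = inner f' g'.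
Proof.
move=> Lf Lf' Lg Lg' ff' gg'; apply: mean_aeq.
- exact: cintegrableM (L2J _).
- exact: cintegrableM (L2J _).
- exact: (@aeq_op2 (fun _ x y => x * y^*)).
Qed.

(** * Fatou's lemma *)

Definition energy f : \bar R := (\int[mu]_(t in @angles R) (nrm2 (f (cis t)))%:E)%E.

Lemma energyE f : L2 f -> energy f = (2 * pi * complex.Re (inner f f))%:E.
Proof.
move=> /L2E[mf jf]; rewrite innerff /= mulrA divff ?mul1r; last first.
  by rewrite gt_eqF // pi2_gt0.
rewrite /energy /Rintegral fineK //; exact: integrable_fin_num jf.
Qed.

(** Balls of L^2 are closed under almost everywhere convergence. *)
Lemma energy_fatou (F : nat -> C -> C) f (B : \bar R) :
  (forall n, mble (F n)) -> mble f ->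
  {ae mu, forall t, angles t ->
     (F n (cis t) : C^o) @[n --> \oo] --> (f (cis t) : C^o)} ->
  (forall n, (energy (F n) <= B)%E) -> (energy f <= B)%E.
Proof.
move=> mF mf Ff FB.
pose G n t := (nrm2 (F n (cis t)))%:E.
have mG n : measurable_fun (@angles R : set (measurableTypeR R)) (G n).
  by apply/measurable_EFinP; exact: (measurable_nrm2 (mF n)).
have G0 n t : angles t -> (0 <= G n t)%E by rewrite lee_fin nrm2_ge0.
have -> : energy f = (\int[mu]_(t in @angles R) limn_einf (G^~ t))%E.
  apply: ae_eq_integral => //.
  - by apply/measurable_EFinP; exact: (measurable_nrm2 mf).
  - apply: measurableT_comp; first exact: oppe_measurable.
    apply: measurable_fun_limn_esup => n.
    by apply: measurableT_comp; first exact: oppe_measurable.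
  - apply: ae_imp Ff => t h tA.
    have cG : G^~ t n @[n --> \oo] --> (nrm2 (f (cis t)))%:E.
      by apply/cvg_EFin; [exact: nearW | exact: cvg_nrm2 (h tA)].
    by rewrite (cvg_limn_einf_sup cG).1.
apply: le_trans (fatou _ _ mG G0) _ => //.
rewrite limn_einf_lim; apply: lime_le; first exact: is_cvg_einfs.
apply: nearW => n; apply: le_trans (FB n).
by apply: ereal_inf_lbound; exists n => //=.
Qed.

End AlmostEverywhere.

(** * The Hardy space *)

Section Hardy.
Variable R : realType.
Local Notation C := R[i].
Local Notation mu := (@lebesgue_measure R).
Implicit Types (f g h F G : C -> C) (z w c : C) (t : R) (a b : nat -> C).

Definition sqsum a := exists B : R, forall N, \sum_(k < N) nrm2 (a k) <= B.

Lemma sum_nrm2E a N :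
  \sum_(k < N) `|a k| ^+ 2 = (\sum_(k < N) nrm2 (a k))%:C%C.
Proof.
by rewrite rmorph_sum; apply: eq_bigr => k _ /=; rewrite nrm2E normCK.
Qed.

Lemma sum_nrm2_homo a :
  {homo (fun N => \sum_(k < N) nrm2 (a k)) : n m / (n <= m)%N >-> n <= m}.
Proof.
move=> n m nm; rewrite -!(big_mkord xpredT (fun k => nrm2 (a k))).
rewrite [leRHS](@big_cat_nat _ _ _ n) //= lerDl.
by apply: sumr_ge0 => k _; apply: nrm2_ge0.
Qed.

Lemma sqsumP a : cvgn (series (fun k => `|a k| ^+ 2 : C^o)) <-> sqsum a.
Proof.
split=> [ca|[B aB]].
  have /cvg_complexP[cr _] := ca.
  have E N : complex.Re (series (fun k => `|a k| ^+ 2 : C^o) N) =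
      \sum_(k < N) nrm2 (a k).
    by rewrite /series /= big_mkord sum_nrm2E.
  exists (complex.Re (lim (series (fun k => `|a k| ^+ 2 : C^o) @ \oo))) => N.
  move: cr; under eq_fun do rewrite E.
  set l := complex.Re _ => cr; rewrite -(cvg_lim (@Rhausdorff R) cr).
  have cu : cvgn (fun n => \sum_(k < n) nrm2 (a k)) by apply/cvg_ex; exists l.
  exact: (nondecreasing_cvgn_le (@sum_nrm2_homo a) cu).
pose u N := \sum_(k < N) nrm2 (a k).
have cu : cvgn u.
  apply: nondecreasing_is_cvgn; first exact: sum_nrm2_homo.
  by exists B => _ [N _ <-]; apply: aB.
apply/cvg_ex; exists ((limn u)%:C%C : C^o); apply/cvg_complexP.
split; under eq_fun do rewrite big_mkord sum_nrm2E; [exact: cu | exact: cvg_cst].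
Qed.

Lemma sqsum_tail a (e : R) M : sqsum a -> 0 < e -> exists2 N, (M <= N)%N &
  forall K, \sum_(k < K) nrm2 (a (N + k)%N) <= e.
Proof.
move=> [B aB] e0; pose u N := \sum_(k < N) nrm2 (a k).
have cu : cvgn u.
  apply: nondecreasing_is_cvgn; first exact: sum_nrm2_homo.
  by exists B => _ [N _ <-]; apply: aB.
have /cvgrPdist_lt/(_ _ e0) [N0 _ hN] := cu.
exists (maxn M N0); first exact: leq_maxl.
set N := maxn _ _ => K.
have h1 := hN N (leq_maxr _ _).
have h2 : u (N + K)%N <= limn u.
  exact: (nondecreasing_cvgn_le (@sum_nrm2_homo a)).
have -> : \sum_(k < K) nrm2 (a (N + k)%N) = u (N + K)%N - u N.
  by rewrite /u big_split_ord /= addrAC subrr add0r.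
move: h1; rewrite ltr_norml => /andP[_ h1].
by apply: ltW; apply: le_lt_trans h1; rewrite lerB.
Qed.

(** The extension F and its coefficients a are kept explicit: products and
    quotients are computed on F, Fourier coefficients are read off from a. *)
Record hardy_data f F a : Prop := HardyData {
  hardy_L2 : L2 f;
  hardy_sq : sqsum a;
  hardy_taylor : forall z, `|z| < 1 ->
    series (fun k => a k * z ^+ k : C^o) @ \oo --> (F z : C^o);
  hardy_radial : {ae mu, forall t, angles t ->
      (fun r : R => F (r%:C%C * cis t) : C^o) @ 1^'- --> (f (cis t) : C^o)} }.

Definition boundary_of f F := exists a, hardy_data f F a.

Lemma H2E f : H2 f <-> exists F, boundary_of f F.
Proof.
split=> [[Lf [F [a /sqsumP sa ta] rF]]|[F [a [Lf /sqsumP sa ta rF]]]].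
  by exists F, a.
by split=> //; exists F => //; exists a.
Qed.

(** * Taylor coefficients as Fourier coefficients *)

Lemma nrm2X z n : nrm2 (z ^+ n) = nrm2 z ^+ n.
Proof.
elim: n => [|n IH]; first by rewrite /nrm2 /= expr0n expr1n addr0.
by rewrite !exprS nrm2M IH.
Qed.

Lemma inner_trigpoly K N (c : nat -> C) :
  let p := fun z => \sum_(k < K) c k * z ^+ (N + k) in
  inner p p = (\sum_(k < K) nrm2 (c k))%:C%C.
Proof.
move=> p; rewrite /p inner_suml; last 2 first.
- by move=> i; apply: L2X.
- by apply: L2_sum => i; apply/L2Z/L2X.
rewrite rmorph_sum; apply: eq_bigr => k _ /=.
rewrite inner_sumr; last 2 first.
- by move=> i; apply: L2X.
- exact: L2X.
rewrite (bigD1 k) //= innerX eqxx mulr1 big1 ?addr0 ?nrm2E // => j jk.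
by rewrite innerX eqn_add2l val_eqE eq_sym (negPf jk) mulr0.
Qed.

Definition psum a N z := \sum_(k < N) a k * z ^+ k.

Lemma L2_psum a N : L2 (psum a N).
Proof. by apply: L2_sum => k; apply/L2Z/L2X. Qed.

Lemma psumD a N K z : psum a (N + K) z =
  psum a N z + \sum_(k < K) a (N + k)%N * z ^+ (N + k).
Proof. by rewrite /psum big_split_ord. Qed.

Lemma cvg_radius (t : R) : (r%:C%C * cis t : C^o) @[r --> 1^'-] --> (cis t : C^o).
Proof.
have l x : r * x @[r --> (1 : R)^'-] --> x.
  rewrite -[X in _ --> X]mul1r; apply: cvgM; last exact: cvg_cst.
  by apply: cvg_at_left_filter; exact: cvg_id.
apply/cvg_complexP; split => /=; under eq_fun do rewrite ?ReM ?ImM /= mul0r ?subr0 ?addr0.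
- exact: l.
- exact: l.
Qed.

(** Fatou's lemma is applied twice: to the partial sums on a circle of radius
    r < 1, and then to r tending to 1. *)
Lemma energy_tail f F a N (e : R) : hardy_data f F a ->
  (forall K, \sum_(k < K) nrm2 (a (N + k)%N) <= e) ->
  complex.Re (inner (fun z => f z - psum a N z) (fun z => f z - psum a N z)) <= e.
Proof.
move=> [Lf sa ta rF] ae.
pose h z : C := f z - psum a N z; rewrite -[X in inner X X]/h.
suff : (energy h <= (2 * pi * e)%:E)%E.
  rewrite energyE; last exact: L2B (L2_psum _ _).
  by rewrite lee_fin ler_pM2l // pi2_gt0.
pose s n : R := 1 - n.+2%:R^-1.
have s0 n : 0 <= s n by rewrite subr_ge0 invf_le1 ?ler1n ?ltr0n.
have s1 n : s n < 1 by rewrite ltrBlDr ltrDl invr_gt0 ltr0n.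
have ss : s n @[n --> \oo] --> (1 : R).
  rewrite -[X in _ --> X]subr0; apply: cvgB; first exact: cvg_cst.
  have := @cvg_harmonic R; rewrite -(cvg_shiftS (@harmonic R)).
  exact.
have ns n t : `|(s n)%:C%C * cis t| < 1.
  by rewrite normrM norm_cis mulr1 normCE /nrm2 /= expr0n addr0 sqrtr_sqr ltcR ger0_norm.
pose tail n K z := \sum_(k < K) (a (N + k)%N * (s n)%:C%C ^+ (N + k)) * z ^+ (N + k).
have Ltail n K : L2 (tail n K) by apply: L2_sum => k; apply/L2Z/L2X.
have tailE n K t : tail n K (cis t) =
    psum a (N + K) ((s n)%:C%C * cis t) - psum a N ((s n)%:C%C * cis t).
  rewrite psumD addrAC subrr add0r; apply: eq_bigr => k _.
  by rewrite exprMn mulrA.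
have tailcvg n t : (tail n K (cis t) : C^o) @[K --> \oo] -->
    (F ((s n)%:C%C * cis t) - psum a N ((s n)%:C%C * cis t) : C^o).
  under eq_fun do rewrite tailE.
  apply: (@cvgB C C^o); last exact: cvg_cst.
  have := ta _ (ns n t); rewrite -(cvg_shiftn N).
  by rewrite /series /=; under eq_fun do rewrite big_mkord addnC.
pose D n z := F ((s n)%:C%C * z) - psum a N ((s n)%:C%C * z).
have mD n : mble (D n).
  split.
    apply: (@measurable_fun_cvg _ _ _ _ (fun K t => complex.Re (tail n K (cis t)))).
      by move=> K; have [] := L2_mble (Ltail n K).
    by move=> t _; have /cvg_complexP[] := tailcvg n t.
  apply: (@measurable_fun_cvg _ _ _ _ (fun K t => complex.Im (tail n K (cis t)))).
    by move=> K; have [] := L2_mble (Ltail n K).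
  by move=> t _; have /cvg_complexP[] := tailcvg n t.
apply: (@energy_fatou R D h (2 * pi * e)%:E mD); first exact: (L2_mble (L2B Lf (L2_psum a N))).
- apply: ae_imp rF => t rF tA; rewrite /D.
  have sl : (s n) @[n --> \oo] --> (1 : R)^'-.
    move=> A /ss A1.
    apply: (@filterS _ \oo _ (fun n => s n < 1 -> A (s n)) _ _ A1) => n.
    by apply; exact: s1.
  have h1 := cvg_comp _ _ sl (rF tA).
  have h2 := cvg_comp _ _ sl (cvg_radius (t := t)).
  pose p : {poly C} := \poly_(k < N) a k.
  have pE z : psum a N z = p.[z] by rewrite horner_poly.
  have h3 : (psum a N ((s n)%:C%C * cis t) : C^o) @[n --> \oo] -->
      (psum a N (cis t) : C^o).
    by under eq_fun do rewrite pE; rewrite pE; apply: cvg_horner h2.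
  exact: (@cvgB C C^o nat \oo _ (fun n => F ((s n)%:C%C * cis t))
    (fun n => psum a N ((s n)%:C%C * cis t)) _ _ h1 h3).
move=> n; apply: (@energy_fatou R (tail n) (D n) _ (fun K => L2_mble (Ltail n K)) (mD n)).
- by apply: aeW => t _; exact: tailcvg.
move=> K; rewrite energyE // lee_fin ler_pM2l ?pi2_gt0 //.
rewrite (inner_trigpoly K N (fun k => a (N + k)%N * (s n)%:C%C ^+ (N + k))) /=.
apply: le_trans (ae K); apply: ler_sum => k _.
rewrite nrm2M -[leRHS]mulr1 ler_wpM2l ?nrm2_ge0 // nrm2X exprn_ile1 ?nrm2_ge0 //.
by rewrite /nrm2 /= expr0n addr0 exprn_ile1 // ltW.
Qed.

(** Bessel's inequality for f - psum a N, whose norm tends to 0. *)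
Lemma hardy_coef f F a g c M : hardy_data f F a -> L2 g -> inner g g = 1 ->
  (forall N, (M <= N)%N -> inner (psum a N) g = c) -> inner f g = c.
Proof.
move=> fFa Lg g1 cE; have [Lf sa _ _] := fFa.
apply/eqP; rewrite -subr_eq0 -nrm2_eq0; apply/eqP/le_anti.
rewrite nrm2_ge0 andbT; apply/ler_addgt0Pr => e e0; rewrite add0r.
have [N MN tN] := sqsum_tail M sa e0.
have Lh := L2B Lf (L2_psum a N).
have := bessel Lh Lg g1.
rewrite innerBl ?cE //; last exact: L2_psum.
rewrite normCK -nrm2E innerff lecR => /le_trans; apply.
have := energy_tail fFa tN.
by rewrite innerff.
Qed.

Lemma boundary_meanX f F k : boundary_of f F ->
  circle_mean (fun z => z ^+ k.+1 * f z) = 0.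
Proof.
move=> [a fFa].
rewrite -[RHS](@hardy_coef f F a (fun z => (z ^+ k.+1)^*) 0 0 fFa) //.
- by apply: mean_eq_circle => t; rewrite conjCK mulrC.
- exact/L2J/L2X.
- rewrite -[RHS](mean_cst 1); apply: mean_eq_circle => t.
  by rewrite conjCK mulrC -nrm2E nrm2X nrm2_cis expr1n.
- move=> N _; rewrite inner_suml; last 2 first.
  + by move=> i; apply: L2X.
  + exact/L2J/L2X.
  rewrite big1 // => i _; rewrite -[X in _ * X](_ : 0 = _) ?mulr0 //.
  rewrite -(meanX R (i + k)); apply: mean_eq_circle => t.
  by rewrite conjCK -exprD addnS.
Qed.

Lemma hardy_innerX f F a k : hardy_data f F a ->
  inner f (fun z => z ^+ k) = a k.
Proof.
move=> fFa; apply: (@hardy_coef f F a _ _ k.+1 fFa); first exact: L2X.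
  by rewrite innerX eqxx.
move=> N kN; rewrite inner_suml; last 2 first.
- by move=> i; apply: L2X.
- exact: L2X.
rewrite (bigD1 (Ordinal kN)) //= innerX eqxx mulr1 big1 ?addr0 // => j jk.
rewrite innerX; have -> : (j == k :> nat) = false.
  by apply: contraNF jk => /eqP jk; apply/eqP/val_inj.
by rewrite mulr0.
Qed.

Lemma boundary_mean f F : boundary_of f F -> circle_mean f = F 0.
Proof.
move=> [a fFa].
have -> : circle_mean f = a 0%N.
  rewrite -(hardy_innerX 0 fFa); apply: mean_eq_circle => t.
  by rewrite expr0 conjC1 mulr1.
have := hardy_taylor fFa (z := 0); rewrite normr0 => /(_ ltr01).
move=> h; apply: (cvg_unique _ _ h); first exact: norm_hausdorff.
apply: cvg_near_cst; exists 1%N => // -[//|n] _.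
rewrite /series /= big_mkord big_ord_recl /= expr0 mulr1 big1 ?addr0 //.
by move=> i _; rewrite exprS mul0r mulr0.
Qed.

End Hardy.

Section HardyClosure.
Variable R : realType.
Local Notation C := R[i].
Local Notation mu := (@lebesgue_measure R).
Implicit Types (f g h F G : C -> C) (z w c : C) (t : R) (a b : nat -> C).

Lemma boundary_L2 f F : boundary_of f F -> L2 f.
Proof. by case=> a []. Qed.

Lemma boundary_aeq f g F : boundary_of f F -> L2 g -> aeq f g -> boundary_of g F.
Proof.
move=> [a [Lf sa ta rF]] Lg fg; exists a; apply: (HardyData Lg sa ta).
by apply: ae_imp2 fg rF => t h1 h2 tA; rewrite -h1 //; apply: h2.
Qed.

Lemma boundary_lin c f g F G : boundary_of f F -> boundary_of g G ->
  boundary_of (fun z => c * f z + g z) (fun z => c * F z + G z).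
Proof.
move=> [a [Lf [A sa] ta rF]] [b [Lg [B sb] tb rG]].
exists (fun k => c * a k + b k); split.
- by apply: L2D => //; apply: L2Z.
- exists (2 * (nrm2 c * A) + 2 * B) => N.
  have le_k k : nrm2 (c * a k + b k) <= 2 * (nrm2 c * nrm2 (a k)) + 2 * nrm2 (b k).
    by apply: le_trans (nrm2D _ _) _; rewrite nrm2M.
  apply: le_trans (ler_sum _ (fun k _ => le_k (nat_of_ord k))) _.
  rewrite big_split /= -!mulr_sumr; apply: lerD; apply: ler_wpM2l => //.
    by apply: ler_wpM2l; [exact: nrm2_ge0 | exact: sa].
  exact: sb.
- move=> z z1; rewrite /series /=.
  under eq_fun => N.
    rewrite (eq_bigr (fun k => c * (a k * z ^+ k) + b k * z ^+ k)); last first.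
      by move=> k _; rewrite mulrDl mulrA.
    rewrite big_split /= -mulr_sumr; over.
  apply: (@cvgD C C^o); last exact: tb.
  apply: (@cvgM C); [exact: cvg_cst | exact: ta].
- apply: ae_imp2 rF rG => t h1 h2 tA.
  apply: (@cvgD C C^o); last exact: h2.
  by apply: (@cvgM C); [exact: cvg_cst | exact: h1].
Qed.

Lemma boundary_cst c : boundary_of (fun=> c) (fun=> c).
Proof.
exists (fun k => if k is 0 then c else 0); split.
- exact: L2_cst.
- exists (nrm2 c) => -[|N]; first by rewrite big_ord0 nrm2_ge0.
  rewrite big_ord_recl /= big1 ?addr0 // => k _.
  by rewrite /nrm2 /= expr0n addr0.
- move=> z _; apply: cvg_near_cst; exists 1%N => // -[//|n] _.
  rewrite /series /= big_mkord big_ord_recl /= expr0 mulr1 big1 ?addr0 //.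
  by move=> i _; rewrite mul0r.
- by apply: aeW => t _; exact: cvg_cst.
Qed.

Lemma boundary_mulX f F : boundary_of f F ->
  boundary_of (fun z => z * f z) (fun z => z * F z).
Proof.
move=> [a [Lf [A sa] ta rF]].
exists (fun k => if k is k'.+1 then a k' else 0); split.
- apply: (@L2_mulb _ id f 1) => //; first exact: mble_id.
  by move=> t; rewrite nrm2_cis.
- exists A => -[|N].
    by rewrite big_ord0; have := sa 0%N; rewrite big_ord0.
  by rewrite big_ord_recl /= {1}/nrm2 /= expr0n addr0 add0r; apply: sa.
- move=> z z1; rewrite -cvg_shiftS /series /=.
  under eq_fun => N.
    rewrite big_nat_recl //= mul0r add0r.
    rewrite (eq_bigr (fun k => z * (a k * z ^+ k))); last first.
      by move=> k _; rewrite exprS mulrCA.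
    rewrite -mulr_sumr; over.
  by apply: (@cvgM C); [exact: cvg_cst | exact: ta].
- apply: ae_imp rF => t h1 tA.
  by apply: (@cvgM C); [exact: cvg_radius | exact: h1].
Qed.

(** * Division by 1 - w z *)

(** The Taylor coefficients of F / (1 - w z), where a are those of F. *)
Fixpoint geom w a k := if k is k'.+1 then a k + w * geom w a k' else a 0%N.

(** Convexity of the square, with weights 1 - r and r. *)
Lemma nrm2_geom x y w (r : R) : nrm2 w = r ^+ 2 -> 0 <= r -> r < 1 ->
  nrm2 (x + w * y) <= nrm2 x / (1 - r) + r * nrm2 y.
Proof.
move=> wr r0 r1.
set X := Num.sqrt (nrm2 x); set Y := Num.sqrt (nrm2 y).
have X2 : nrm2 x = X ^+ 2 by rewrite sqr_sqrtr ?nrm2_ge0.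
have Y2 : nrm2 y = Y ^+ 2 by rewrite sqr_sqrtr ?nrm2_ge0.
have le1 : nrm2 (x + w * y) <= (X + r * Y) ^+ 2.
  have X0 : 0 <= X by exact: sqrtr_ge0.
  have Y0 : 0 <= Y by exact: sqrtr_ge0.
  have := ler_normD x (w * y); rewrite normrM !normCE -rmorphM -rmorphD lecR /=.
  rewrite wr sqrtr_sqr ger0_norm // -/X -/Y => h.
  rewrite -[leLHS]sqr_sqrtr ?nrm2_ge0 // ler_sqr ?nnegrE ?sqrtr_ge0 //.
  by rewrite addr_ge0 // mulr_ge0.
apply: (le_trans le1); rewrite X2 Y2.
have r1' : 0 < 1 - r by rewrite subr_gt0.
rewrite -subr_ge0.
have -> : X ^+ 2 / (1 - r) + r * Y ^+ 2 - (X + r * Y) ^+ 2 =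
    r * (X - (1 - r) * Y) ^+ 2 / (1 - r).
  by field; rewrite gt_eqF.
by rewrite divr_ge0 ?(ltW r1') // mulr_ge0 // sqr_ge0.
Qed.

Lemma sqsum_geom w a : `|w| < 1 -> sqsum a -> sqsum (geom w a).
Proof.
move=> w1 [B aB].
set r := Num.sqrt (nrm2 w).
have r0 : 0 <= r by exact: sqrtr_ge0.
have r1 : r < 1 by move: w1; rewrite normCE ltcR.
have wr : nrm2 w = r ^+ 2 by rewrite sqr_sqrtr ?nrm2_ge0.
have r1' : 0 < 1 - r by rewrite subr_gt0.
have B0 : 0 <= B by have := aB 0%N; rewrite big_ord0.
exists (B / (1 - r) / (1 - r)).
have step N : \sum_(k < N.+1) nrm2 (geom w a k) <=
    (\sum_(k < N.+1) nrm2 (a k)) / (1 - r) + r * \sum_(k < N) nrm2 (geom w a k).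
  rewrite !big_ord_recl /= mulrDl -[leRHS]addrA; apply: lerD.
    by rewrite ler_pdivlMr // ler_piMr ?nrm2_ge0 // lerBlDr lerDl.
  rewrite mulr_suml mulr_sumr -big_split /=; apply: ler_sum => k _.
  exact: nrm2_geom.
elim=> [|N IH]; first by rewrite big_ord0 !divr_ge0 // ltW.
apply: le_trans (step N) _.
have h : (\sum_(k < N.+1) nrm2 (a k)) / (1 - r) <= B / (1 - r).
  by rewrite ler_pM2r ?invr_gt0.
apply: le_trans (lerD h (ler_wpM2l r0 IH)) _.
by rewrite le_eqVlt; apply/orP; left; apply/eqP; field; rewrite gt_eqF.
Qed.

(** The partial sums satisfy the equation (1 - w z) G = F up to a term that
    tends to 0 on the disk. *)
Lemma geom_psum w a N z : (1 - w * z) * psum (geom w a) N.+1 z =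
  psum a N.+1 z - w * geom w a N * z ^+ N.+1.
Proof.
elim: N => [|N IH].
  by rewrite /psum !big_ord1 /= expr0 expr1 mulr1; ring.
rewrite /psum big_ord_recr [in RHS]big_ord_recr mulrDr /= -!/(psum _ _ _) IH.
by rewrite !exprS; ring.
Qed.

Lemma cvg0_dom (u : nat -> C) (v : nat -> R) : (forall n, `|u n| <= (v n)%:C%C) ->
  v n @[n --> \oo] --> (0 : R) -> (u n : C^o) @[n --> \oo] --> (0 : C^o).
Proof.
move=> uv /cvgrPdist_lt v0; apply/cvgrPdist_lt => e /gt0C[r r0 ->].
apply: filterS (v0 r r0) => n; rewrite !sub0r !normrN => h.
apply: le_lt_trans (uv n) _; rewrite ltcR.
exact: le_lt_trans (ler_norm _) h.
Qed.

Lemma subr1_neq0 w z : `|w| < 1 -> `|z| <= 1 -> 1 - w * z != 0.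
Proof.
move=> w1 z1; rewrite subr_eq0; apply/negP => /eqP h.
have : `|w * z| < 1.
  by rewrite normrM; apply: le_lt_trans w1; rewrite ler_piMr.
by rewrite -h normr1 ltxx.
Qed.

Lemma taylor_geom w a F z : `|w| < 1 -> `|z| < 1 -> sqsum a ->
  series (fun k => a k * z ^+ k : C^o) @ \oo --> (F z : C^o) ->
  series (fun k => geom w a k * z ^+ k : C^o) @ \oo --> (F z / (1 - w * z) : C^o).
Proof.
move=> w1 z1 sa ta.
have [B dB] := sqsum_geom w1 sa.
have q0 : 1 - w * z != 0 by rewrite subr1_neq0 // ltW.
rewrite -cvg_shiftS /series /=.
under eq_fun => N.
  rewrite big_mkord -/(psum (geom w a) N.+1 z).
  rewrite -[psum _ _ _](mulKf q0) geom_psum mulrC; over.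
apply: (@cvgM C); last exact: cvg_cst.
rewrite -[X in _ --> X]subr0; apply: (@cvgB C C^o).
  move: ta; rewrite -cvg_shiftS /series /=.
  by under eq_fun do rewrite big_mkord.
set r := Num.sqrt (nrm2 z).
have r0 : 0 <= r by exact: sqrtr_ge0.
have r1 : r < 1 by move: z1; rewrite normCE ltcR.
apply: (@cvg0_dom _ (fun N => Num.sqrt B * r ^+ N.+1)) => [N|].
  rewrite !normrM normrX -mulrA -[leRHS]mul1r; apply: ler_pM; first exact: normr_ge0.
  - by apply: mulr_ge0 => //; rewrite exprn_ge0.
  - exact: ltW.
  rewrite [`|z|]normCE -/r -rmorphXn /= rmorphM /=; apply: ler_wpM2r.
    by rewrite ler0c exprn_ge0.
  rewrite normCE lecR ler_wsqrtr //; apply: le_trans (dB N.+1).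
  by rewrite big_ord_recr /= lerDr sumr_ge0 // => k _; rewrite nrm2_ge0.
rewrite -[X in _ --> X](mulr0 (Num.sqrt B)); apply: cvgM; first exact: cvg_cst.
rewrite (cvg_shiftS (fun n => r ^+ n)).
by apply: cvg_expr; rewrite ger0_norm.
Qed.

Lemma cvg_cis t : (cis s : C^o) @[s --> t] --> (cis t : C^o).
Proof.
by apply/cvg_complexP; split => /=; [exact: continuous_cos | exact: continuous_sin].
Qed.

Lemma cvg_inv_linear (T : Type) (E : set_system T) {FF : Filter E} (u : T -> C) w z :
  `|w| < 1 -> `|z| <= 1 -> (u x : C^o) @[x --> E] --> (z : C^o) ->
  ((1 - w * u x)^-1 : C^o) @[x --> E] --> ((1 - w * z)^-1 : C^o).
Proof.
move=> w1 z1 uz; apply: (@cvgV C); first exact: subr1_neq0.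
apply: (@cvgB C C^o); first exact: cvg_cst.
by apply: (@cvgM C); [exact: cvg_cst | exact: uz].
Qed.

Lemma mble_inv_linear w : `|w| < 1 -> mble (fun z => (1 - w * z)^-1).
Proof.
move=> w1.
have c t : ((1 - w * cis s)^-1 : C^o) @[s --> t] --> ((1 - w * cis t)^-1 : C^o).
  apply: cvg_inv_linear; [exact: w1 | by rewrite norm_cis | exact: cvg_cis].
split; apply: measurable_funTS; apply: continuous_measurable_fun => t.
- by have /cvg_complexP[] := c t.
- by have /cvg_complexP[] := c t.
Qed.

Lemma nrm2_inv_linear w t : `|w| < 1 ->
  nrm2 (1 - w * cis t)^-1 <= (1 - Num.sqrt (nrm2 w)) ^- 2.
Proof.
move=> w1; set r := Num.sqrt _.
have r1 : r < 1 by move: w1; rewrite normCE ltcR.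
have h : (1 - r)%:C%C <= `|1 - w * cis t|.
  have := lerB_dist 1 (w * cis t).
  by rewrite normr1 normrM norm_cis mulr1 [`|w|]normCE -/r -rmorphB.
have h2 : (1 - r) ^+ 2 <= nrm2 (1 - w * cis t).
  move: h; rewrite normCE lecR => h.
  rewrite -[leRHS]sqr_sqrtr ?nrm2_ge0 // ler_sqr ?nnegrE ?sqrtr_ge0 //.
  by rewrite subr_ge0 ltW.
have p : 0 < (1 - r) ^+ 2 by rewrite exprn_gt0 // subr_gt0.
have -> : nrm2 (1 - w * cis t)^-1 = (nrm2 (1 - w * cis t))^-1.
  by apply: complexI; rewrite fmorphV /= !nrm2E fmorphV -invfM.
by rewrite lef_pV2 // posrE // (lt_le_trans p).
Qed.

Lemma boundary_div w f F : `|w| < 1 -> boundary_of f F ->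
  boundary_of (fun z => f z / (1 - w * z)) (fun z => F z / (1 - w * z)).
Proof.
move=> w1 [a [Lf sa ta rF]]; exists (geom w a); split.
- rewrite (_ : (fun _ => _) = fun z => (1 - w * z)^-1 * f z); last first.
    by apply/funext => z; rewrite mulrC.
  apply: (L2_mulb _ _ Lf); first exact: mble_inv_linear.
  by move=> t; exact: nrm2_inv_linear.
- exact: sqsum_geom.
- by move=> z z1; apply: taylor_geom => //; exact: ta.
- apply: ae_imp rF => t h1 tA.
  apply: (@cvgM C); first exact: h1.
  apply: cvg_inv_linear; [exact: w1 | by rewrite norm_cis | exact: cvg_radius].
Qed.

Lemma boundary_horner (p : {poly C}) f F : boundary_of f F ->
  boundary_of (fun z => p.[z] * f z) (fun z => p.[z] * F z).
Proof.
move=> fF; elim/poly_ind: p => [|p c IH].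
  have := boundary_cst 0; congr (boundary_of _ _); apply/funext => z;
  by rewrite horner0 mul0r.
have := boundary_lin c fF (boundary_mulX IH).
congr (boundary_of _ _); apply/funext => z;
by rewrite hornerMXaddC mulrDl [RHS]addrC mulrA [z * _]mulrC.
Qed.

End HardyClosure.

(** * Finite Blaschke products *)

Section Blaschke.
Variable R : realType.
Local Notation C := R[i].
Implicit Types (f g h F G : C -> C) (z w c : C) (t : R).

Lemma model_spaceE (u f : C -> C) : model_space u f <->
  (exists F, boundary_of f F) /\
  forall h H, boundary_of h H -> inner f (fun z => u z * h z) = 0.
Proof.
split=> [[/H2E fF orth]|[fF orth]]; split=> //; try exact/H2E.
- by move=> h H hH; apply: orth; apply/H2E; exists H.
- by move=> h /H2E[H hH]; apply: orth hH.
Qed.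

Lemma norm1_mulJ z : `|z| = 1 -> z * z^* = 1.
Proof. by move=> z1; rewrite -normCK z1 expr1n. Qed.

Lemma norm1_neq0 z : `|z| = 1 -> z != 0.
Proof. by move=> z1; rewrite -normr_eq0 z1 oner_neq0. Qed.

Section Product.
Variables (m : nat) (a : 'I_m -> C).
Hypothesis a_lt1 : forall i, `|a i| < 1.

Definition bnum : {poly C} := \prod_(i < m) ((a i)%:P - 'X).
Definition bden : {poly C} := \prod_(i < m) (1 - (a i)^* *: 'X).

Lemma bnum_horner z : bnum.[z] = \prod_(i < m) (a i - z).
Proof.
by rewrite /bnum horner_prod; apply: eq_bigr => i _; rewrite !hornerE.
Qed.

Lemma bden_horner z : bden.[z] = \prod_(i < m) (1 - (a i)^* * z).
Proof.
by rewrite /bden horner_prod; apply: eq_bigr => i _; rewrite !hornerE.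
Qed.

Lemma blaschkeE z : blaschke a z = bnum.[z] / bden.[z].
Proof. by rewrite bnum_horner bden_horner -prodf_div. Qed.

Lemma bden_neq0 z : `|z| <= 1 -> bden.[z] != 0.
Proof.
move=> z1; rewrite bden_horner; apply/prodf_neq0 => i _.
by apply: subr1_neq0 => //; rewrite norm_conjC.
Qed.

Lemma bden0 : bden.[0] = 1.
Proof. by rewrite bden_horner big1 // => i _; rewrite mulr0 subr0. Qed.

(** The factors satisfy conj(a - z) = - conj(z) (1 - conj(a) z) on the circle;
    in particular numerator and denominator have the same modulus there. *)
Lemma bnumJ z : `|z| = 1 -> bnum.[z]^* = (-1) ^+ m * (z^* ^+ m * bden.[z]).
Proof.
move=> /norm1_mulJ zz; rewrite bnum_horner bden_horner rmorph_prod.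
rewrite -[m in (-1) ^+ m]card_ord -[m in z^* ^+ m]card_ord -!prodr_const.
rewrite -!big_split; apply: eq_bigr => i _ /=.
by rewrite rmorphB mulrBr mulr1 mulrCA [z^* * z]mulrC zz mulr1 mulN1r opprB.
Qed.

Lemma blaschke_norm1 z : `|z| = 1 -> `|blaschke a z| = 1.
Proof.
move=> z1; have d0 : bden.[z] != 0 by rewrite bden_neq0 ?z1.
rewrite blaschkeE normrM normfV -[`|bnum.[z]|]norm_conjC bnumJ //.
rewrite !normrM !normrX normrN1 expr1n mul1r norm_conjC z1 expr1n mul1r.
by rewrite divff // normr_eq0.
Qed.

Lemma blaschke_mulJ z : `|z| = 1 -> blaschke a z * (blaschke a z)^* = 1.
Proof. by move=> z1; apply/norm1_mulJ/blaschke_norm1. Qed.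

Lemma boundary_bden f F : boundary_of f F ->
  boundary_of (fun z => f z / bden.[z]) (fun z => F z / bden.[z]).
Proof.
move=> fF.
have E (u : C -> C) : (fun z => u z / bden.[z]) =
    (fun z => foldr (fun i x => x / (1 - (a i)^* * z)) (u z) (index_enum 'I_m)).
  apply/funext => z; rewrite bden_horner; elim: (index_enum _) => [|i s IH] /=.
    by rewrite big_nil invr1 mulr1.
  by rewrite big_cons invfM -IH; ring.
rewrite !E; elim: (index_enum _) => //= i s IH.
by apply: boundary_div => //; rewrite norm_conjC.
Qed.

Lemma boundary_frac (p : {poly C}) :
  boundary_of (fun z => p.[z] / bden.[z]) (fun z => p.[z] / bden.[z]).
Proof.
have := boundary_bden (boundary_horner p (boundary_cst (1 : C))).
by congr boundary_of; apply/funext => z; rewrite mulr1.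
Qed.

Lemma L2_blaschke_mul f : L2 f -> L2 (fun z => blaschke a z * f z).
Proof.
apply: (@L2_mulb _ _ _ 1) => [|t].
  have := boundary_L2 (boundary_frac bnum).
  by move=> /L2_mble; congr mble; apply/funext => z; rewrite blaschkeE.
have := blaschke_mulJ (norm_cis t); rewrite -nrm2E => /complexI ->.
by [].
Qed.

Lemma L2_blaschkeJ_mul f : L2 f -> L2 (fun z => (blaschke a z)^* * f z).
Proof.
move=> Lf; have := L2J (L2_blaschke_mul (L2J Lf)).
by apply: L2_eq_circle => t; rewrite rmorphM /= conjCK.
Qed.

(** The analytic extension is a polynomial on the disk, hence so are its radial
    limits. *)
Lemma hardy_poly f F (b : nat -> C) M : hardy_data f F b ->
  (forall k, (M <= k)%N -> b k = 0) -> aeq f (horner (\poly_(k < M) b k)).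
Proof.
move=> [Lf sb tb rF] b0; set p := \poly_(k < M) b k.
have Fp z : `|z| < 1 -> F z = p.[z].
  move=> z1; apply: (cvg_unique _ (tb z z1)); first exact: norm_hausdorff.
  apply: cvg_near_cst; exists M => // N /= MN.
  rewrite /series /= (@big_cat_nat _ _ _ M) //= big_mkord /p horner_poly.
  rewrite [X in _ + X]big_nat_cond [X in _ + X]big1 ?addr0 // => k.
  by rewrite andbT => /andP[Mk _]; rewrite b0 // mul0r.
apply: ae_imp rF => t h tA.
have h2 : (p.[r%:C%C * cis t] : C^o) @[r --> (1 : R)^'-] --> (p.[cis t] : C^o).
  by apply: cvg_horner; exact: cvg_radius.
apply: (cvg_unique _ (h tA)); first exact: norm_hausdorff.
apply: cvg_trans h2; apply: near_eq_cvg.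
near=> r; rewrite Fp // normrM norm_cis mulr1 normCE /nrm2 /= expr0n addr0.
rewrite sqrtr_sqr ltcR ger0_norm; first by near: r; exact: nbhs_left_lt.
by near: r; apply: nbhs_left_ge.
Unshelve. all: by end_near. Qed.

(** On the circle, [bden] times the conjugate of z ^ m is up to sign the
    conjugate of [bnum], which is u times [bden]. As f is orthogonal to
    u [bden] z ^ j, the product of f and [bden] is orthogonal to z ^ (m + j). *)
Lemma model_space_frac f : model_space (blaschke a) f ->
  exists2 p : {poly C}, (size p <= m)%N & aeq f (fun z => p.[z] / bden.[z]).
Proof.
move=> /model_spaceE[[F fF] orth].
have [b gG] := boundary_horner bden fF.
have Lf := boundary_L2 fF.
have b0 k : (m <= k)%N -> b k = 0.
  move=> mk; rewrite -(hardy_innerX k gG) -(subnK mk); set j := (k - m)%N.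
  have := orth _ _ (boundary_horner (bden * 'X^j) (boundary_cst 1)).
  move=> /(congr1 (fun x => (-1) ^+ m * x)); rewrite mulr0 => <-.
  have sq1 : (-1) ^+ m * (-1) ^+ m = 1 :> C.
    by rewrite -exprMn mulrNN mulr1 expr1n.
  rewrite -innerZl //; last first.
    by apply: L2_blaschke_mul; apply: boundary_L2 (boundary_horner _ (boundary_cst 1)).
  apply: mean_eq_circle => t; have c1 := norm_cis t.
  have d0 : bden.[cis t] != 0 by rewrite bden_neq0 ?c1.
  rewrite mulr1 hornerM hornerXn mulrA blaschkeE divfK //.
  rewrite !rmorphM /= bnumJ // !rmorphXn exprD.
  by rewrite -[LHS]mul1r -{1}sq1 /=; ring.
exists (\poly_(k < m) b k); first exact: size_poly.
apply: ae_imp (hardy_poly gG b0) => t h tA; rewrite -h //.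
by rewrite mulrC mulKf // bden_neq0 ?norm_cis.
Qed.

End Product.
End Blaschke.

(** * Clark bases *)

Section PolynomialLemmas.
Variable K : fieldType.

(** For a product of n factors of degree at most 1, the degree may drop, so the
    coefficient of degree n takes the place of the leading coefficient. *)
Lemma coef_prod_linear n (p : 'I_n -> {poly K}) : (forall i, (size (p i) <= 2)%N) ->
  (size (\prod_(i < n) p i)%R <= n.+1)%N /\
  (\prod_(i < n) p i)`_n = \prod_(i < n) (p i)`_1.
Proof.
elim: n p => [|n IH] p sp; first by rewrite !big_ord0 size_poly1 coef1.
rewrite !big_ord_recr /=; set q := \prod_(i < n) _.
have [sq cq] := IH _ (fun i => sp (widen_ord (leqnSn n) i)).
split.
  apply: leq_trans (size_polyMleq _ _) _.
  by have := leq_add sq (sp ord_max); rewrite !addnS addn0; case: (size q + _)%N.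
rewrite coefM big_ord_recr big_ord_recr /= subnn subSnn cq.
rewrite [X in _ + X]mulrC [q`_n.+1]nth_default // mulr0 addr0.
rewrite big1 ?add0r // => i _; rewrite [(p _)`_ _]nth_default ?mulr0 //.
by apply: leq_trans (sp _) _; rewrite subSn ?ltnS ?subn_gt0 // ltnW.
Qed.

Variables (m : nat) (x : 'I_m -> K).
Hypothesis x_inj : injective x.

Definition others p : {poly K} := \prod_(q < m | q != p) ('X - (x q)%:P).

Lemma others_horner p z : (others p).[z] = \prod_(q < m | q != p) (z - x q).
Proof. by rewrite horner_prod; apply: eq_bigr => q _; rewrite hornerXsubC. Qed.

Lemma others_neq0 p z : (forall q, q != p -> z != x q) -> (others p).[z] != 0.
Proof.
by move=> h; rewrite others_horner; apply/prodf_neq0 => q qp; rewrite subr_eq0 h.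
Qed.

Lemma others_self p : (others p).[x p] != 0.
Proof. by apply: others_neq0 => q qp; rewrite inj_eq // eq_sym. Qed.

Lemma others_ne p q : q != p -> (others p).[x q] = 0.
Proof. by move=> qp; rewrite others_horner (bigD1 q) //= subrr mul0r. Qed.

Lemma others_mul p : ('X - (x p)%:P) * others p = \prod_(q < m) ('X - (x q)%:P).
Proof. by rewrite /others [RHS](bigD1 p). Qed.

Lemma size_nodal : size (\prod_(q < m) ('X - (x q)%:P)) = m.+1.
Proof.
by have := size_prod_XsubC (enum 'I_m) x; rewrite big_enum size_enum_ord.
Qed.

Lemma monic_others p : others p \is monic.
Proof. exact: monic_prod_XsubC. Qed.

Lemma size_others p : size (others p) = m.
Proof.
have := size_nodal; rewrite -(others_mul p) size_monicM ?monicXsubC ?monic_neq0 ?monic_others //.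
by rewrite size_XsubC /= => -[].
Qed.

Lemma lagrange_others (q : {poly K}) : (size q <= m)%N ->
  q = \sum_(p < m) (q.[x p] / (others p).[x p]) *: others p.
Proof.
move=> sq; apply/eqP; rewrite -subr_eq0; apply/eqP.
apply: (@roots_geq_poly_eq0 _ _ [seq x i | i <- enum 'I_m]).
- apply/allP => _ /mapP[i _ ->]; rewrite rootE !hornerE horner_sum (bigD1 i) //=.
  rewrite hornerZ divfK ?others_self // big1 ?addr0 ?subrr // => j ji.
  by rewrite hornerZ (@others_ne j i) ?mulr0 // eq_sym.
- by rewrite map_inj_uniq ?enum_uniq.
- rewrite size_map size_enum_ord; apply: leq_trans (size_polyD _ _) _.
  rewrite geq_max sq size_polyN; apply: leq_trans (size_sum _ _ _) _.
  apply/bigmax_leqP => i _; apply: leq_trans (size_scale_leq _ _) _.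
  by rewrite size_others.
Qed.

End PolynomialLemmas.

Section KernelIdentities.
Variable R : realType.
Local Notation C := R[i].
Implicit Types (u v : C -> C) (z w eta zeta : C).

Lemma bkernel_self u eta : `|eta| = 1 -> bkernel u eta eta = 0.
Proof.
by move=> /norm1_mulJ e; rewrite /bkernel mulrC -[eta^* * eta]mulrC e subrr invr0 mul0r.
Qed.

Lemma norm1_subr_neq0 eta z : `|eta| = 1 -> z != eta -> 1 - eta^* * z != 0.
Proof.
move=> e1; apply: contra; rewrite subr_eq0 => /eqP h.
by rewrite -[z]mul1r -(norm1_mulJ e1) -mulrA -h mulr1.
Qed.

(** On the circle |u z| = 1, so multiplication by u z turns 1 - u eta conj(u z)
    into a multiple of 1 - conj(u eta) u z, and multiplication by z does the
    same to the denominator. This carries orthogonality to u H^2 over to the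
    vanishing of means of z times a function in H^2. *)
Lemma bkernel_conj u eta z : `|eta| = 1 -> `|z| = 1 -> `|u eta| = 1 ->
  `|u z| = 1 ->
  (bkernel u eta z)^* * u z = u eta * eta^* * z * bkernel u eta z.
Proof.
move=> e1 z1 ue1 uz1; have [->|ne] := eqVneq z eta.
  by rewrite bkernel_self // conjC0 mul0r mulr0.
have h1 := norm1_subr_neq0 e1 ne.
have h2 : 1 - eta * z^* != 0.
  by rewrite -conjC_eq0 rmorphB rmorphM /= conjCK conjC1.
rewrite /bkernel rmorphM fmorphV !rmorphB !rmorphM !rmorph1 /= !conjCK.
have E1 := norm1_mulJ e1; have Z1 := norm1_mulJ z1.
have U1 := norm1_mulJ ue1; have V1 := norm1_mulJ uz1.
set x := u eta in U1 *; set y := u z in V1 *.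
apply: (mulfI h1); apply: (mulfI h2).
transitivity ((1 - eta^* * z) * (y - x * (y * y^*))).
  by field; rewrite h2.
transitivity ((1 - eta * z^*) * (eta^* * z) * (x - (x * x^*) * y)); last first.
  by field; rewrite h1.
rewrite V1 U1 mulr1 mul1r.
transitivity ((eta^* * z - (eta * eta^*) * (z * z^*)) * (x - y)); last by ring.
by rewrite E1 Z1; ring.
Qed.

(** Partial fractions in z. The first summand depends on zeta only through
    v zeta, and the second one on eta only through u eta; these values are the
    same for all points of a Clark basis. *)
Lemma bkernel_split u v eta zeta z : `|eta| = 1 -> `|zeta| = 1 -> `|z| = 1 ->
  z != eta -> z != zeta ->
  (eta - zeta) * eta^* * (bkernel u eta z * (bkernel v zeta z)^*) =
  eta^* * z * bkernel u eta z * (1 - v zeta * (v z)^*)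
  + (1 - (u eta)^* * u z) * (bkernel v zeta z)^*.
Proof.
move=> e1 d1 z1 ne nd.
have h1 := norm1_subr_neq0 e1 ne.
have h2 : 1 - zeta * z^* != 0.
  by rewrite -conjC_eq0 rmorphB rmorphM /= conjCK conjC1 norm1_subr_neq0.
rewrite /bkernel rmorphM fmorphV !rmorphB !rmorphM !rmorph1 /= !conjCK.
have E1 := norm1_mulJ e1; have Z1 := norm1_mulJ z1.
set X := 1 - _ * u z; set Y := 1 - _ * (v z)^*.
have -> : (eta - zeta) * eta^* * (X / (1 - eta^* * z) * (Y / (1 - zeta * z^*))) =
  (eta * eta^* - zeta * eta^*) * (X / (1 - eta^* * z) * (Y / (1 - zeta * z^*))).
  by ring.
apply: (mulfI h1); apply: (mulfI h2).
transitivity ((1 - zeta * eta^*) * X * Y).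
  by rewrite E1; field; rewrite h1 h2.
transitivity ((eta^* * z * (1 - zeta * z^*) + (1 - eta^* * z)) * X * Y); last first.
  by field; rewrite h1 h2.
congr (_ * _ * _).
transitivity (1 - eta^* * zeta * (z * z^*)); last by ring.
by rewrite Z1; ring.
Qed.

End KernelIdentities.

Section ClarkBasis.
Variable R : realType.
Local Notation C := R[i].
Variables (m : nat) (a : 'I_m.+1 -> C) (lambda : C) (eta : 'I_m.+1 -> C).
Hypothesis a_lt1 : forall i, `|a i| < 1.
Hypothesis clark : clark_points (blaschke a) lambda eta.
Implicit Types (f g h F G : C -> C) (z w c : C) (t : R) (p q : 'I_m.+1).

Local Notation u := (blaschke a).
Local Notation k p := (bkernel u (eta p)).
Local Notation E p := (others eta p).

Definition clark_val : C := clark_value u lambda.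
Local Notation w0 := clark_val.

Let eta1 p : `|eta p| = 1. Proof. exact: clark_circle clark p. Qed.
Let eta_inj : injective eta. Proof. exact: clark_inj clark. Qed.

Lemma clark_valE p : u (eta p) = w0. Proof. exact: clark_sol clark p. Qed.

Lemma clark_val_norm1 : `|w0| = 1.
Proof. by rewrite -(clark_valE ord0) blaschke_norm1. Qed.
Let w1 := clark_val_norm1.

(** The numerator of 1 - conj(w0) u, whose zeros are the Clark points. *)
Definition clark_poly : {poly C} := bden a - w0^* *: bnum a.

Lemma clark_polyE z : (bden a).[z] != 0 ->
  1 - w0^* * u z = clark_poly.[z] / (bden a).[z].
Proof.
by move=> d0; rewrite blaschkeE /clark_poly hornerD hornerN hornerZ; field.
Qed.

Lemma size_bden : (size (bden a) <= m.+2)%N /\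
  (bden a)`_m.+1 = \prod_(i < m.+1) - (a i)^*.
Proof.
have [|h1 h2] := @coef_prod_linear _ m.+1 (fun i => 1 - (a i)^* *: 'X).
  move=> i; apply: leq_trans (size_polyD _ _) _; rewrite geq_max size_poly1 size_polyN.
  by apply: leq_trans (size_scale_leq _ _) _; rewrite size_polyX.
split; first exact: h1.
rewrite h2; apply: eq_bigr => i _.
by rewrite coefB coefZ coefX coef1 /= mulr1 sub0r.
Qed.

Lemma size_bnum : (size (bnum a) <= m.+2)%N /\
  (bnum a)`_m.+1 = \prod_(i < m.+1) -1.
Proof.
have [|h1 h2] := @coef_prod_linear _ m.+1 (fun i => (a i)%:P - 'X).
  move=> i; apply: leq_trans (size_polyD _ _) _; rewrite geq_max size_polyN size_polyX.
  by rewrite (leq_trans (size_polyC_leq1 _)).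
split; first exact: h1.
rewrite h2; apply: eq_bigr => i _.
by rewrite coefB coefC coefX /= sub0r.
Qed.

(** The degree is at most m + 1, there are m + 1 roots eta p, and the polynomial
    does not vanish at the zeros of u. *)
Lemma clark_poly_factor :
  clark_poly = lead_coef clark_poly *: \prod_(p < m.+1) ('X - (eta p)%:P).
Proof.
pose rs := [seq eta p | p <- enum 'I_m.+1].
have urs : uniq rs by rewrite map_inj_uniq ?enum_uniq.
have srs : size rs = m.+1 by rewrite size_map size_enum_ord.
have ars : all (root clark_poly) rs.
  apply/allP => _ /mapP[p _ ->]; rewrite rootE.
  have d0 : (bden a).[eta p] != 0 by rewrite bden_neq0 ?eta1.
  have := clark_polyE d0; rewrite clark_valE [w0^* * _]mulrC norm1_mulJ // subrr => /esym/eqP.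
  by rewrite mulf_eq0 invr_eq0 (negPf d0) orbF.
have n0 : clark_poly != 0.
  apply/eqP => c0; have := clark_polyE (bden_neq0 a_lt1 (ltW (a_lt1 ord0))).
  rewrite c0 horner0 mul0r blaschkeE bnum_horner (bigD1 ord0) //= subrr.
  by rewrite !mul0r mulr0 subr0 => /eqP; rewrite oner_eq0.
have sz : size clark_poly = (size rs).+1.
  apply/eqP; rewrite eqn_leq max_poly_roots // andbT srs.
  apply: leq_trans (size_polyD _ _) _; rewrite geq_max size_polyN size_bden.1.
  by apply: leq_trans (size_scale_leq _ _) _; exact: size_bnum.1.
rewrite {1}(all_roots_prod_XsubC sz ars) ?uniq_rootsE //.
by rewrite /rs big_map big_enum.
Qed.

Lemma clark_lead_neq0 : lead_coef clark_poly != 0.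
Proof.
rewrite lead_coef_eq0; apply/eqP => c0; have := clark_polyE (bden_neq0 a_lt1 (ltW (a_lt1 ord0))).
rewrite c0 horner0 mul0r blaschkeE bnum_horner (bigD1 ord0) //= subrr.
by rewrite !mul0r mulr0 subr0 => /eqP; rewrite oner_eq0.
Qed.

Definition kcoef p := - eta p * lead_coef clark_poly.

Lemma kcoef_neq0 p : kcoef p != 0.
Proof. by apply: mulf_neq0; [rewrite oppr_eq0 norm1_neq0 | exact: clark_lead_neq0]. Qed.

(** The continuous extension of the kernel, a multiple of the p-th Lagrange
    polynomial of the points eta over the denominator of the Blaschke product. *)
Definition kfun p z := kcoef p * (E p).[z] / (bden a).[z].

Lemma kfun_sub p z : (bden a).[z] != 0 -> 1 - w0^* * u z = (1 - (eta p)^* * z) * kfun p z.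
Proof.
move=> d0; rewrite clark_polyE // /kfun clark_poly_factor -(others_mul eta p).
rewrite hornerZ hornerM hornerXsubC /kcoef.
have e := norm1_mulJ (eta1 p).
rewrite [RHS](_ : _ = (eta p * (eta p)^* * z - eta p) *
   (lead_coef clark_poly * (E p).[z] / (bden a).[z])); last by ring.
rewrite e; ring.
Qed.

Lemma bkernelE p z : `|z| <= 1 -> z != eta p -> k p z = kfun p z.
Proof.
move=> z1 ne; rewrite /bkernel clark_valE (kfun_sub p) ?bden_neq0 // mulrC mulKf //.
exact: norm1_subr_neq0.
Qed.

Lemma bkernel_if p t : k p (cis t) = if cis t == eta p then 0 else kfun p (cis t).
Proof.
have [->|ne] := eqVneq; first by rewrite bkernel_self.
by rewrite bkernelE // norm_cis.
Qed.

Lemma boundary_kfun p : boundary_of (kfun p) (kfun p).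
Proof.
have := boundary_frac a_lt1 (kcoef p *: E p).
by congr boundary_of; apply/funext => z; rewrite hornerZ.
Qed.

Lemma aeq_bkernel p : aeq (k p) (kfun p).
Proof.
apply: (@aeq_off _ [:: eta p]) => t; rewrite inE => ne.
by rewrite bkernelE // norm_cis.
Qed.

Lemma L2_bkernel p : L2 (k p).
Proof.
have Lk := boundary_L2 (boundary_kfun p).
apply: (@L2_dom _ _ (kfun p) 1) => //; last first.
  move=> t; rewrite mul1r bkernel_if; case: ifP => // _.
  by rewrite {1}/nrm2 /= expr0n addr0 nrm2_ge0.
have [mr mi] := L2_mble Lk.
pose eqb t := (cos t == complex.Re (eta p)) && (sin t == complex.Im (eta p)).
have meq : measurable_fun (@angles R) eqb.
  have [cm sm] := mble_id R.
  apply: measurable_and.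
  - exact: (measurable_fun_eqr cm (measurable_cst _)).
  - exact: (measurable_fun_eqr sm (measurable_cst _)).
have mA : measurable (@angles R) by exact: measurable_angles.
have mif (v : R -> R) : measurable_fun (@angles R) v ->
    measurable_fun (@angles R) (fun t => if eqb t then 0 else v t).
  move=> mv; apply: (measurable_fun_if mA meq); first exact: measurable_cst.
  by apply: measurable_funS mv.
split.
- under eq_fun do rewrite bkernel_if eq_complex /= -/(eqb _) (fun_if (@complex.Re R)).
  exact: mif.
- under eq_fun do rewrite bkernel_if eq_complex /= -/(eqb _) (fun_if (@complex.Im R)).
  exact: mif.
Qed.

Lemma boundary_bkernel p : boundary_of (k p) (kfun p).
Proof.
apply: boundary_aeq (boundary_kfun p) (L2_bkernel p) _.
exact/aeq_sym/aeq_bkernel.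
Qed.

Lemma bkernelJ p t :
  (k p (cis t))^* * u (cis t) = w0 * (eta p)^* * cis t * k p (cis t).
Proof.
rewrite bkernel_conj ?clark_valE ?norm_cis ?eta1 //.
by rewrite blaschke_norm1 ?norm_cis.
Qed.

(** By [bkernel_conj] the scalar product is a multiple of the mean of z k h,
    where k h is a boundary function of H^2. *)
Lemma inner_mul_bkernel p h H : boundary_of h H ->
  inner (fun z => u z * h z) (k p) = 0.
Proof.
move=> hH.
have kh : aeq (fun z => (kcoef p *: E p).[z] * (h z / (bden a).[z]))
    (fun z => k p z * h z).
  apply: ae_imp (aeq_bkernel p) => t e tA; rewrite e // /kfun hornerZ; ring.
have L1 : L2 (fun z => (kcoef p *: E p).[z] * (h z / (bden a).[z])).
  exact: boundary_L2 (boundary_horner _ (boundary_bden a_lt1 hH)).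
have Lkh : L2 (fun z => k p z * h z).
  apply: (L2_dom (M := 1) _ _ L1) => [|t].
    by apply: mbleM; apply: L2_mble; [exact: L2_bkernel | exact: boundary_L2 hH].
  rewrite mul1r bkernel_if; case: ifP => _.
    by rewrite mul0r {1}/nrm2 /= expr0n addr0 nrm2_ge0.
  rewrite (_ : _ * h _ = (kcoef p *: E p).[cis t] * (h (cis t) / (bden a).[cis t])) //.
  by rewrite /kfun hornerZ; ring.
have := boundary_meanX 0 (boundary_aeq (boundary_horner _ (boundary_bden a_lt1 hH)) Lkh kh).
move=> /(congr1 (fun x => w0 * (eta p)^* * x)); rewrite mulr0 => <-.
rewrite -meanZ; last first.
  by apply: L2_mulb (1) _ _ Lkh => [|t]; [exact: mbleX | rewrite expr1 nrm2_cis].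
apply: mean_eq_circle => t; rewrite expr1.
rewrite [LHS](_ : _ = (k p (cis t))^* * u (cis t) * h (cis t)); last by ring.
by rewrite bkernelJ; ring.
Qed.

End ClarkBasis.

Section ClarkOrthonormal.
Variable R : realType.
Local Notation C := R[i].
Variables (m : nat) (a : 'I_m.+1 -> C) (lambda : C) (eta : 'I_m.+1 -> C).
Hypothesis a_lt1 : forall i, `|a i| < 1.
Hypothesis clark : clark_points (blaschke a) lambda eta.
Implicit Types (f g h F G : C -> C) (z w c : C) (t : R) (p q : 'I_m.+1).

Local Notation u := (blaschke a).
Local Notation k p := (bkernel u (eta p)).
Local Notation E p := (others eta p).
Local Notation w0 := (clark_val a lambda).
Local Notation kf := (kfun a lambda eta).

Let eta1 p : `|eta p| = 1. Proof. exact: clark_circle clark p. Qed.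
Let eta_inj : injective eta. Proof. exact: clark_inj clark. Qed.
Let ue p : u (eta p) = w0. Proof. exact: clark_valE clark p. Qed.
Let w1 : `|w0| = 1. Proof. exact: clark_val_norm1 a_lt1 clark. Qed.
Let bk p : boundary_of (k p) (kf p). Proof. exact: boundary_bkernel. Qed.
Let Lk p : L2 (k p). Proof. exact: boundary_L2 (bk p). Qed.

Lemma bkernel_model p : model_space u (k p).
Proof.
apply/model_spaceE; split; first by exists (kf p); apply: bk.
move=> h H hH; have Lh := boundary_L2 hH.
rewrite (innerJ (L2_blaschke_mul a_lt1 Lh) (Lk p)).
by rewrite (inner_mul_bkernel a_lt1 clark p hH) conjC0.
Qed.

Lemma kfun0 p : kf p 0 = 1 - w0^* * u 0.
Proof.
have d0 : (bden a).[0] != 0 by rewrite bden0 oner_neq0.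
by rewrite (kfun_sub a_lt1 clark p d0) mulr0 subr0 mul1r.
Qed.

Lemma kfun0_neq0 : 1 - w0^* * u 0 != 0.
Proof.
rewrite -(kfun0 ord0) /kfun bden0 divr1 mulf_neq0 ?kcoef_neq0 //.
apply: others_neq0 => q _; apply/eqP => e0.
by have := eta1 q; rewrite -e0 normr0 => /eqP; rewrite eq_sym oner_eq0.
Qed.

Lemma mean_bkernel p : circle_mean (k p) = 1 - w0^* * u 0.
Proof. by rewrite (boundary_mean (bk p)) kfun0. Qed.

Lemma bkernelJ_mul p t :
  u (cis t) * (k p (cis t))^* = w0 * (eta p)^* * cis t * k p (cis t).
Proof. by rewrite mulrC (bkernelJ a_lt1 clark). Qed.

Lemma mean_X1_bkernel p : circle_mean (fun z => z * k p z) = 0.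
Proof.
by rewrite -[RHS](boundary_meanX 0 (bk p)); apply: mean_eq_circle => t; rewrite expr1.
Qed.

Lemma mean_blaschke_bkernelJ p : circle_mean (fun z => u z * (k p z)^*) = 0.
Proof.
rewrite -[RHS](mulr0 (w0 * (eta p)^*)) -(mean_X1_bkernel p) -meanZ; last first.
  by apply: L2_mulb (1) (mble_id R) _ (Lk p) => t; rewrite nrm2_cis.
by apply: mean_eq_circle => t; rewrite bkernelJ_mul mulrA.
Qed.

(** In [bkernel_split] for u = v the mean of the first summand does not depend
    on p, and it is the opposite of the mean of the second one. *)
Lemma bkernel_ortho p q : p != q -> inner (k p) (k q) = 0.
Proof.
move=> pq; set c := (eta p - eta q) * (eta p)^*.
have c0 : c != 0.
  apply: mulf_neq0; last by rewrite conjC_eq0 norm1_neq0.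
  by rewrite subr_eq0 inj_eq.
apply: (mulfI c0); rewrite mulr0.
pose g z := - w0 * (eta p)^* * (z * k p z).
have Lzk : L2 (fun z => z * k p z).
  by apply: L2_mulb (1) (mble_id R) _ (Lk p) => t; rewrite nrm2_cis.
have Luk : L2 (fun z => u z * (k q z)^*) by apply/(L2_blaschke_mul a_lt1)/L2J.
pose rhs z := ((eta p)^* * (z * k p z) + (-1) * (k p z)^*)
  + ((k q z)^* + (- w0^*) * (u z * (k q z)^*)).
have Lrhs : L2 rhs.
  apply: L2D; first by apply: L2D; apply: L2Z => //; apply: L2J.
  by apply: L2D; [apply: L2J | apply: L2Z].
have E : aeq (fun z => c * (k p z * (k q z)^*)) rhs.
  apply: (@aeq_off _ [:: eta p; eta q]) => t; rewrite !inE negb_or => /andP[ne1 ne2].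
  have z1 := norm_cis t.
  rewrite /c (bkernel_split u u (eta1 p) (eta1 q) z1 ne1 ne2) /rhs !ue.
  have U1 := blaschke_mulJ a_lt1 z1.
  have h := bkernelJ_mul p t.
  have h2 : (k p (cis t))^* = w0 * (eta p)^* * cis t * k p (cis t) * (u (cis t))^*.
    by rewrite -h mulrAC U1 mul1r.
  by rewrite h2; ring.
have cI := cintegrableM (Lk p) (L2J (Lk q)).
rewrite /inner -mean_scale // (mean_aeq (cintegrableZ c cI) (cintegrable_L2 Lrhs) E).
rewrite /rhs meanD; last 2 first.
- by apply: L2D; apply: L2Z => //; apply: L2J.
- by apply: L2D; [apply: L2J | apply: L2Z].
rewrite !meanD ?meanZ; try by [exact: Lzk | exact: Luk | exact: L2J | apply: L2Z; exact: L2J | exact: L2Z].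
rewrite !meanJ // mean_X1_bkernel mean_blaschke_bkernelJ !mean_bkernel.
by rewrite !mulr0 add0r addr0 mulN1r addNr.
Qed.

(** * The norm of the kernels and the derivative *)

(** The reproducing kernel of the origin in the model space. *)
Definition at0 z := 1 - (u 0)^* * u z.

Definition at0_poly : {poly C} := bden a - (u 0)^* *: bnum a.

Lemma at0E z : `|z| <= 1 -> at0 z = at0_poly.[z] / (bden a).[z].
Proof.
move=> z1; rewrite /at0 [u z]blaschkeE /at0_poly hornerD hornerN hornerZ.
by field; exact: bden_neq0.
Qed.

(** The coefficients of degree m + 1 cancel, since u 0 is the product of the
    zeros of u. *)
Lemma size_at0_poly : (size at0_poly <= m.+1)%N.
Proof.
have [sd cd] := size_bden a; have [sn cn] := size_bnum a.
apply/leq_sizeP => j; rewrite leq_eqVlt => /orP[/eqP<-|mj].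
  rewrite /at0_poly coefB coefZ cd cn blaschkeE bden0 divr1 bnum_horner.
  rewrite rmorph_prod -big_split /=; apply/eqP; rewrite subr_eq0; apply/eqP.
  by apply: eq_bigr => i _; rewrite subr0 mulrN1.
rewrite /at0_poly coefB coefZ !nth_default ?mulr0 ?subr0 //.
- exact: leq_trans sn mj.
- exact: leq_trans sd mj.
Qed.

Lemma bden_eta_neq0 p : (bden a).[eta p] != 0.
Proof. by rewrite bden_neq0 // eta1. Qed.

Lemma frac_lagrange (s : {poly C}) z : (size s <= m.+1)%N ->
  s.[z] / (bden a).[z] =
  \sum_p (s.[eta p] / (E p).[eta p] / kcoef a lambda eta p) * kf p z.
Proof.
move=> ss; rewrite {1}(lagrange_others eta_inj ss) horner_sum mulr_suml.
apply: eq_bigr => p _; rewrite hornerZ /kfun.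
have h : kcoef a lambda eta p != 0 by exact: kcoef_neq0.
by rewrite [RHS]mulrA [in RHS]mulrA divfK.
Qed.

Lemma inner_at0 q : inner at0 (k q) = (1 - w0^* * u 0)^*.
Proof.
have Luk : L2 (fun z => u z * (k q z)^*) by apply/(L2_blaschke_mul a_lt1)/L2J.
transitivity (circle_mean (fun z => - (u 0)^* * (u z * (k q z)^*) + (k q z)^*)).
  by apply: mean_eq_circle => t; rewrite /at0; ring.
rewrite meanD ?meanZ ?meanJ ?mean_bkernel ?mean_blaschke_bkernelJ ?mulr0 ?add0r //.
- exact: L2Z.
- exact: L2J.
Qed.

Lemma inner_kfun_bkernel p q : inner (kf p) (k q) = inner (k p) (k q).
Proof.
apply: inner_aeq => //; first exact: boundary_L2 (boundary_kfun lambda eta a_lt1 p).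
- exact/aeq_sym/aeq_bkernel.
- exact: aeq_refl.
Qed.

(** The expansion of the reproducing kernel of the origin in the kernels k p
    determines their norms: both its scalar product with k p and its value at
    eta p are known. *)
Lemma bkernel_norm q : inner (k q) (k q) = kf q (eta q).
Proof.
set c0 := 1 - w0^* * u 0.
have c00 : c0^* != 0 by rewrite conjC_eq0 kfun0_neq0.
pose c p := at0_poly.[eta p] / (E p).[eta p] / kcoef a lambda eta p.
have h1 : inner at0 (k q) = c q * inner (k q) (k q).
  transitivity (inner (fun z => \sum_p c p * kf p z) (k q)).
    by apply: mean_eq_circle => t; rewrite at0E ?norm_cis // frac_lagrange ?size_at0_poly.
  rewrite inner_suml //; last first.
    by move=> p; exact: boundary_L2 (boundary_kfun lambda eta a_lt1 p).
  rewrite (bigD1 q) //= inner_kfun_bkernel big1 ?addr0 // => p pq.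
  by rewrite inner_kfun_bkernel bkernel_ortho ?mulr0.
have h2 : at0_poly.[eta q] = c0^* * (bden a).[eta q].
  rewrite -[LHS](divfK (bden_eta_neq0 q)) -(at0E (z := eta q)) ?eta1 // /at0 ue.
  by rewrite /c0 rmorphB rmorphM /= conjCK rmorph1; ring.
move: h1; rewrite inner_at0 -/c0 /c h2 => h1.
have n1 := bden_eta_neq0 q; have n2 := others_self eta_inj q.
have n3 : kcoef a lambda eta q != 0 by exact: kcoef_neq0.
apply: (mulfI c00); rewrite [in RHS]h1 /kfun; field.
by rewrite n1 n2 n3.
Qed.

Lemma bkernel_norm_neq0 q : inner (k q) (k q) != 0.
Proof.
rewrite bkernel_norm; apply: mulf_neq0; last by rewrite invr_eq0 bden_eta_neq0.
by apply: mulf_neq0; [exact: kcoef_neq0 | exact: others_self].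
Qed.

Lemma blaschke_diff q z : (bden a).[z] != 0 ->
  u z - u (eta q) = w0 * (eta q)^* * kf q z * (z - eta q).
Proof.
move=> d0; rewrite ue; have h := kfun_sub a_lt1 clark q d0.
have ww := norm1_mulJ w1; have ee := norm1_mulJ (eta1 q).
rewrite [LHS](_ : _ = - w0 * (1 - w0^* * u z)); last by ring: ww.
by rewrite h; ring: ee.
Qed.

Lemma derive1_blaschke q :
  derive1 (u : C -> C^o) (eta q) = w0 * (eta q)^* * kf q (eta q).
Proof.
have d0 := bden_eta_neq0 q.
have cd : (h + eta q : C^o) @[h --> (0 : C^o)^'] --> (eta q : C^o).
  rewrite -[X in _ --> X]add0r; apply: (@cvgD C C^o); last exact: cvg_cst.
  exact: (@cvg_within_filter _ _ id (nbhs (0 : C^o)) _ (nbhs (0 : C^o))).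
have cden : ((bden a).[h + eta q] : C^o) @[h --> (0 : C^o)^'] --> ((bden a).[eta q] : C^o).
  exact: cvg_horner cd.
have ckf : (kf q (h + eta q) : C^o) @[h --> (0 : C^o)^'] --> (kf q (eta q) : C^o).
  have cE : ((E q).[h + eta q] : C^o) @[h --> (0 : C^o)^'] --> ((E q).[eta q] : C^o).
    exact: cvg_horner cd.
  have c1 : (kcoef a lambda eta q * (E q).[h + eta q] : C^o) @[h --> (0 : C^o)^']
      --> (kcoef a lambda eta q * (E q).[eta q] : C^o).
    by apply: (@cvgM C); [exact: cvg_cst | exact: cE].
  have c2 : ((bden a).[h + eta q]^-1 : C^o) @[h --> (0 : C^o)^']
      --> ((bden a).[eta q]^-1 : C^o).
    by apply: (@cvgV C); [exact: d0 | exact: cden].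
  by apply: (@cvgM C); [exact: c1 | exact: c2].
rewrite /derive1; apply: cvg_lim; first exact: norm_hausdorff.
have cw : (w0 * (eta q)^* * kf q (h + eta q) : C^o) @[h --> (0 : C^o)^'] -->
    (w0 * (eta q)^* * kf q (eta q) : C^o).
  by apply: (@cvgM C); [exact: cvg_cst | exact: ckf].
apply: cvg_trans cw; apply: near_eq_cvg.
near=> h.
have h0 : h != 0 by near: h; exact: nbhs_dnbhs_neq.
rewrite blaschke_diff; last by near: h; apply: cvgr_neq0 cden d0.
by rewrite addrK /GRing.scale /=; field.
Unshelve. all: by end_near. Qed.

(** By [derive1_blaschke] the derivative is kfun q (eta q) up to a unimodular
    factor, and this number is the squared norm of the kernel. *)
Lemma sqrt_derivE q : sqrt_deriv u (eta q) = (L2norm (k q))%:C%C.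
Proof.
have L0 : 0 <= (L2norm (k q))%:C%C by rewrite ler0c sqrtr_ge0.
rewrite /sqrt_deriv derive1_blaschke.
have -> : `|w0 * (eta q)^* * kf q (eta q)| = kf q (eta q).
  by rewrite normrM (normrM w0) norm_conjC w1 eta1 !mul1r -bkernel_norm ger0_norm ?innerff_ge0 //.
rewrite -bkernel_norm -L2normE.
by rewrite sqrCK.
Qed.

Lemma sqrt_deriv_neq0 q : sqrt_deriv u (eta q) != 0.
Proof.
apply/eqP; rewrite sqrt_derivE => e; have := bkernel_norm_neq0 q.
by rewrite -L2normE e expr0n eqxx.
Qed.

End ClarkOrthonormal.

Section ModelSpace.
Variable R : realType.
Local Notation C := R[i].
Implicit Types (f g h F G : C -> C) (z w c : C) (t : R).

Section Linear.
Variables (m : nat) (a : 'I_m -> C).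
Hypothesis a_lt1 : forall i, `|a i| < 1.
Local Notation u := (blaschke a).

Lemma model_L2 f : model_space u f -> L2 f.
Proof. by move=> /model_spaceE[[F /boundary_L2]]. Qed.

Lemma model_lin c f g : model_space u f -> model_space u g ->
  model_space u (fun z => c * f z + g z).
Proof.
move=> Kf Kg; have Lf := model_L2 Kf; have Lg := model_L2 Kg.
move: Kf Kg => /model_spaceE[[F fF] fo] /model_spaceE[[G gG] go].
apply/model_spaceE; split; first by eexists; apply: boundary_lin fF gG.
move=> h H hH; have Lh := L2_blaschke_mul a_lt1 (boundary_L2 hH).
by rewrite inner_linl // (fo _ _ hH) (go _ _ hH) mulr0 addr0.
Qed.

Lemma model0 : model_space u (fun=> 0).
Proof.
apply/model_spaceE; split; first by eexists; apply: boundary_cst.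
by move=> h H hH; rewrite -[RHS]mean0; apply: mean_eq_circle => t; rewrite mul0r.
Qed.

Lemma model_sum (I : Type) (s : seq I) (c : I -> C) (f : I -> C -> C) :
  (forall i, model_space u (f i)) ->
  model_space u (fun z => \sum_(i <- s) c i * f i z).
Proof.
move=> Kf; elim: s => [|i s IH].
  by under eq_fun do rewrite big_nil; apply: model0.
by under eq_fun do rewrite big_cons; apply: model_lin.
Qed.

Lemma linear_op_sum (K : set (C -> C)) (A : (C -> C) -> C -> C)
    (I : Type) (s : seq I) (c : I -> C) (f : I -> C -> C) :
  linear_op (model_space u) K A -> (forall i, model_space u (f i)) ->
  aeq (A (fun z => \sum_(i <- s) c i * f i z)) (fun z => \sum_(i <- s) c i * A (f i) z).
Proof.
move=> hA Kf; elim: s => [|i s IH].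
  have := linear_op_lin hA (-1) model0 model0.
  have -> : (fun z => -1 * 0 + 0) = (fun=> 0 : C).
    by apply/funext => z; rewrite mulr0 addr0.
  have -> : (fun z => \sum_(i <- [::]) c i * f i z) = (fun=> 0 : C).
    by apply/funext => z; rewrite big_nil.
  by apply: ae_imp => t h tA; rewrite big_nil h // mulN1r addNr.
have -> : (fun z => \sum_(j <- i :: s) c j * f j z) =
    (fun z => c i * f i z + (\sum_(j <- s) c j * f j z)).
  by apply/funext => z; rewrite big_cons.
apply: aeq_trans (linear_op_lin hA (c i) (Kf i) (model_sum s c Kf)) _.
by apply: ae_imp IH => t h tA; rewrite big_cons h.
Qed.

End Linear.

Section Basis.
Variables (m : nat) (a : 'I_m.+1 -> C) (lambda : C) (eta : 'I_m.+1 -> C).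
Hypothesis a_lt1 : forall i, `|a i| < 1.
Hypothesis clark : clark_points (blaschke a) lambda eta.
Implicit Types (p q : 'I_m.+1).

Local Notation u := (blaschke a).
Local Notation k p := (bkernel u (eta p)).
Local Notation v p := (clark_vec u (eta p)).
Local Notation d p := (sqrt_deriv u (eta p)).

Lemma clark_vecE p z : v p z = (d p)^-1 * k p z.
Proof. by rewrite (sqrt_derivE a_lt1 clark). Qed.

Lemma sqrt_derivJ p : (d p)^* = d p.
Proof. by rewrite (sqrt_derivE a_lt1 clark) [LHS]conjc_real. Qed.

Lemma model_clark p : model_space u (v p).
Proof.
have := model_lin a_lt1 (d p)^-1 (bkernel_model a_lt1 clark p) (model0 a).
by congr model_space; apply/funext => z; rewrite addr0 clark_vecE.
Qed.

Lemma L2_clark p : L2 (v p).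
Proof. exact: model_L2 (model_clark p). Qed.

Lemma inner_clark p q : inner (v p) (v q) = (p == q)%:R.
Proof.
have Lk i : L2 (k i) by exact: model_L2 (bkernel_model a_lt1 clark i).
have d0 i : d i != 0 := sqrt_deriv_neq0 a_lt1 clark i.
have -> : inner (v p) (v q) = (d p)^-1 * (d q)^-1 * inner (k p) (k q).
  transitivity (inner (fun z => (d p)^-1 * k p z) (fun z => (d q)^-1 * k q z)).
    by apply: mean_eq_circle => t; rewrite !clark_vecE.
  rewrite innerZl //; last exact: L2Z.
  rewrite (innerJ (L2Z _ (Lk q)) (Lk p)) innerZl // rmorphM /= -innerJ //.
  by rewrite fmorphV /= sqrt_derivJ mulrA.
have [->|pq] := eqVneq p q; last by rewrite (bkernel_ortho a_lt1 clark) ?mulr0.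
rewrite -L2normE -(sqrt_derivE a_lt1 clark) [RHS]mulr1n.
by have dq := d0 q; field; exact: dq.
Qed.

Lemma inner_clark_sum (c : 'I_m.+1 -> C) p :
  inner (fun z => \sum_q c q * v q z) (v p) = c p.
Proof.
rewrite inner_suml; [|exact: L2_clark|exact: L2_clark].
transitivity (\sum_q c q * (q == p)%:R).
  by apply: eq_bigr => q _; rewrite inner_clark.
rewrite (bigD1 p isT) /= eqxx mulr1 big1 ?addr0 // => q qp.
by rewrite (negPf qp) mulr0.
Qed.

Lemma L2_clark_sum (c : 'I_m.+1 -> C) : L2 (fun z => \sum_q c q * v q z).
Proof. by apply: L2_sum => q; apply/L2Z/L2_clark. Qed.

(** By [model_space_frac] an element of the model space is a polynomial of
    degree at most m over [bden]; Lagrange interpolation at the m + 1 points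
    eta p writes it as a combination of kernels. *)
Lemma clark_expansion f : model_space u f ->
  aeq f (fun z => \sum_p inner f (v p) * v p z).
Proof.
move=> Kf; have Lf := model_L2 Kf.
have [s ss fs] := model_space_frac a_lt1 Kf.
pose c p := s.[eta p] / (others eta p).[eta p] / kcoef a lambda eta p * d p.
have fc : aeq f (fun z => \sum_p c p * v p z).
  apply: aeq_trans fs _.
  apply: (@aeq_trans _ _ (fun z => \sum_p (c p / d p) * kfun a lambda eta p z)).
    apply: aeq_circle => t; rewrite (frac_lagrange a_lt1 clark _ ss).
    apply: eq_bigr => p _; congr (_ * _); rewrite /c mulfK //.
    exact: (sqrt_deriv_neq0 a_lt1 clark).
  apply: aeq_sum => p; apply: ae_imp (aeq_bkernel a_lt1 clark p) => t e tA.
  by rewrite -e // clark_vecE [RHS]mulrA.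
have cE p : c p = inner f (v p).
  rewrite (inner_aeq Lf (L2_clark_sum c) (L2_clark p) (L2_clark p) fc (aeq_refl _)).
  by rewrite inner_clark_sum.
by apply: ae_imp fc => t h tA; rewrite h //; apply: eq_bigr => p _; rewrite cE.
Qed.

Lemma norm_clark_sum (c : 'I_m.+1 -> C) :
  inner (fun z => \sum_q c q * v q z) (fun z => \sum_q c q * v q z) =
  \sum_p c p * (c p)^*.
Proof.
rewrite inner_suml; [|exact: L2_clark|exact: L2_clark_sum].
apply: eq_bigr => p _; congr (_ * _).
by rewrite (innerJ (L2_clark_sum c) (L2_clark p)) inner_clark_sum.
Qed.

Lemma inner_clark_eq0 g f : L2 g -> model_space u f ->
  (forall p, inner g (v p) = 0) -> inner g f = 0.
Proof.
move=> Lg Kf g0; rewrite (inner_aeq Lg Lg (model_L2 Kf) (L2_clark_sum _)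
  (aeq_refl g) (clark_expansion Kf)).
rewrite inner_sumr //; last exact: L2_clark.
by rewrite big1 // => p _; rewrite g0 mulr0.
Qed.

End Basis.
End ModelSpace.

(** * Hermite interpolation and a trigonometric moment problem *)

Section Hermite.
Variable K : fieldType.
Implicit Types (H G P U : {poly K}).

(** Induction on the nodes: a multiple of the square of the nodal polynomial V of
    the other nodes changes neither values nor derivatives there. *)
Lemma hermite (s : seq K) (X T : K -> K) : uniq s ->
  exists H, forall e, e \in s -> H.[e] = X e /\ H^`().[e] = T e.
Proof.
elim: s => [|e s IH] /=; first by exists 0.
move=> /andP[es us]; have [H hH] := IH us.
pose V : {poly K} := \prod_(x <- s) ('X - x%:P).
have V0 : V.[e] != 0.
  rewrite /V horner_prod prodf_seq_neq0; apply/allP => x xs /=.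
  by rewrite hornerXsubC subr_eq0; apply: contraNneq es => ->.
have Vs x : x \in s -> V.[x] = 0.
  by move=> xs; rewrite /V horner_prod (big_rem x) //= hornerXsubC subrr mul0r.
pose c := (X e - H.[e]) / V.[e] ^+ 2.
pose d := (T e - H^`().[e] - 2%:R * V.[e] * V^`().[e] * c) / V.[e] ^+ 2.
exists (H + V ^+ 2 * (c%:P + d *: ('X - e%:P))) => x.
have dE y : (H + V ^+ 2 * (c%:P + d *: ('X - e%:P)))^`().[y] =
   H^`().[y] + 2%:R * V.[y] * V^`().[y] * (c + d * (y - e)) + V.[y] ^+ 2 * d.
  rewrite derivD derivM expr2 derivM derivD derivZ derivB derivC derivX derivC.
  rewrite subr0 add0r !(hornerD, hornerM, hornerZ, hornerC, hornerN, hornerX) .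
  by rewrite -addrA; congr (_ + _); rewrite -expr2; ring.
have hE y : (H + V ^+ 2 * (c%:P + d *: ('X - e%:P))).[y] =
   H.[y] + V.[y] ^+ 2 * (c + d * (y - e)).
  by rewrite !(hornerD, hornerM, hornerZ, hornerC, hornerN, hornerX, horner_exp).
rewrite inE dE hE => /orP[/eqP->|xs].
  by rewrite subrr mulr0 addr0 /d /c; split; field; rewrite V0.
by have [h1 h2] := hH x xs; rewrite Vs // expr0n /= mulr0 !mul0r !addr0.
Qed.

End Hermite.

Section DividedDifferences.
Variable K : fieldType.
Variables (m n : nat) (eta : 'I_m -> K) (zeta : 'I_n -> K).
Hypotheses (eta_inj : injective eta) (zeta_inj : injective zeta).
Variables (x : 'I_m -> K) (y : 'I_n -> K) (t : 'I_n -> 'I_m -> K).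
Hypothesis xy : forall s p, t s p * (eta p - zeta s) = x p - y s.

(** Hermite interpolation: where eta p differs from zeta s the divided difference
    is determined by the values x p and y s, and at a common point it is the
    derivative, which can be prescribed. *)
Lemma divided_differences : exists H : {poly K}, forall s p, exists G,
  H = (x p)%:P + ('X - (eta p)%:P) * ((t s p)%:P + ('X - (zeta s)%:P) * G).
Proof.
pose X e := if [pick p | eta p == e] is Some p then x p
  else if [pick s | zeta s == e] is Some s then y s else 0.
pose T e := if [pick ps : 'I_m * 'I_n | (eta ps.1 == e) && (zeta ps.2 == e)]
  is Some ps then t ps.2 ps.1 else 0.
have [H hH] := hermite X T (undup_uniq (codom eta ++ codom zeta)).
have Xe p : X (eta p) = x p.
  rewrite /X; case: pickP => [q /eqP/eta_inj->//|/(_ p)].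
  by rewrite eqxx.
have Xz s : X (zeta s) = y s.
  rewrite /X; case: pickP => [q /eqP e|_].
    by have := xy s q; rewrite e subrr mulr0 => /esym/eqP; rewrite subr_eq0 => /eqP.
  by case: pickP => [q /eqP/zeta_inj->//|/(_ s)]; rewrite eqxx.
have He p : H.[eta p] = x p.
  by rewrite -Xe; apply: (hH _ _).1; rewrite mem_undup mem_cat codom_f.
have Hz s : H.[zeta s] = y s.
  by rewrite -Xz; apply: (hH _ _).1; rewrite mem_undup mem_cat codom_f orbT.
have Hd s p : eta p = zeta s -> H^`().[eta p] = t s p.
  move=> e; rewrite (hH _ _).2; last by rewrite mem_undup mem_cat codom_f.
  rewrite /T; case: pickP => [[q r] /= /andP[/eqP/eta_inj-> /eqP h]|/(_ (p, s))].
    by rewrite (zeta_inj (etrans h e)).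
  by rewrite /= e !eqxx.
exists H => s p.
have /factor_theorem[H1 H1E] : root (H - (x p)%:P) (eta p).
  by rewrite rootE !hornerE He subrr.
have HE : H = (x p)%:P + H1 * ('X - (eta p)%:P) by rewrite -H1E addrC subrK.
have H1z : H1.[zeta s] = t s p.
  have [e|ne] := eqVneq (eta p) (zeta s).
    rewrite -(Hd s p e) -e HE derivD derivC derivM derivXsubC add0r mulr1.
    by rewrite !hornerE subrr mulr0 add0r.
  have d0 : eta p - zeta s != 0 by rewrite subr_eq0.
  apply: (mulIf d0); rewrite xy -(Hz s) HE hornerD hornerM hornerC hornerXsubC.
  by ring.
have /factor_theorem[G GE] : root (H1 - (t s p)%:P) (zeta s).
  by rewrite rootE !hornerE H1z subrr.
exists G; rewrite {1}HE; congr (_ + _); rewrite mulrC; congr (_ * _).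
by rewrite mulrC -GE addrC subrK.
Qed.

Local Notation U := (\prod_(p < m) ('X - (eta p)%:P) * \prod_(s < n) ('X - (zeta s)%:P)).

(** With U the nodal polynomial of all the points, the linear functional sends
    P to the sum of the residues of P H / U, read off from the leading
    coefficient of the remainder of P H modulo U. Its value at
    U / ((X - eta p) (X - zeta s)) is the divided difference of H. *)
Lemma moment_functional : exists2 L : {poly K} -> K,
  (forall c P Q, L (c *: P + Q) = c * L P + L Q) &
  forall s p, L (others eta p * others zeta s) = t s p.
Proof.
have [H hH] := divided_differences.
exists (fun P => ((P * H) %% U)`_(m + n).-1) => [c P Q|s p].
  by rewrite mulrDl modpD -scalerAl modpZl coefD coefZ.
have [G ->] := hH s p.
set E := others eta p; set E' := others zeta s.
have UE : U = ('X - (eta p)%:P) * ('X - (zeta s)%:P) * (E * E').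
  by rewrite -(others_mul eta p) -(others_mul zeta s) -/E -/E' mulrACA.
have -> : E * E' * ((x p)%:P + ('X - (eta p)%:P) * ((t s p)%:P + ('X - (zeta s)%:P) * G))
    = G * U + (x p *: (E * E') + t s p *: (('X - (eta p)%:P) * (E * E'))).
  by rewrite UE -!mul_polyC; ring.
have mE : E * E' \is monic by rewrite monicMr monic_others.
have sE : size (E * E') = (m + n).-1.
  by rewrite size_monicM ?monic_neq0 ?monic_others // !size_others.
have sXE : size (('X - (eta p)%:P) * (E * E')) = (m + n).-1.+1.
  by rewrite size_monicM ?monicXsubC ?monic_neq0 // size_XsubC sE.
have sU : size U = (m + n).+1.
  rewrite size_monicM ?monic_prod_XsubC ?monic_neq0 ?monic_prod_XsubC //.
  by rewrite !size_nodal addnS.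
have mn0 : (0 < m + n)%N by rewrite (leq_trans _ (leq_addr _ _)) // (leq_ltn_trans _ (ltn_ord p)).
rewrite modp_addl_mul_small; last first.
  rewrite sU ltnS; apply: leq_trans (size_polyD _ _) _; rewrite geq_max.
  rewrite (leq_trans (size_scale_leq _ _)) ?sE ?leq_pred //=.
  by rewrite (leq_trans (size_scale_leq _ _)) // sXE prednK.
rewrite coefD !coefZ nth_default ?sE // mulr0 add0r.
have -> : (('X - (eta p)%:P) * (E * E'))`_(m + n).-1 = 1.
  have : ('X - (eta p)%:P) * (E * E') \is monic by rewrite monicMr // monicXsubC.
  by move=> /monicP; rewrite /lead_coef sXE.
by rewrite mulr1.
Qed.

End DividedDifferences.

(** * Matrices of truncated Toeplitz operators *)

Section TwoClarkBases.
Variable R : realType.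
Local Notation C := R[i].
Variables (m n : nat) (a : 'I_m.+1 -> C) (b : 'I_n.+1 -> C).
Variables (lambda1 lambda2 : C) (eta : 'I_m.+1 -> C) (zeta : 'I_n.+1 -> C).
Hypotheses (a_lt1 : forall i, `|a i| < 1) (b_lt1 : forall i, `|b i| < 1).
Hypothesis clark1 : clark_points (blaschke a) lambda1 eta.
Hypothesis clark2 : clark_points (blaschke b) lambda2 zeta.
Variable A : (C -> C) -> C -> C.
Hypothesis hA : linear_op (model_space (blaschke a)) (model_space (blaschke b)) A.
Variable r : 'M[C]_(n.+1, m.+1).
Hypothesis hr : is_matrix_of A (fun p => clark_vec (blaschke a) (eta p))
  (fun s => clark_vec (blaschke b) (zeta s)) r.
Implicit Types (f g h : C -> C) (z w c : C) (t : R) (p : 'I_m.+1) (s : 'I_n.+1).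

Local Notation u := (blaschke a).
Local Notation v := (blaschke b).
Local Notation k p := (bkernel u (eta p)).
Local Notation l s := (bkernel v (zeta s)).
Local Notation V p := (clark_vec u (eta p)).
Local Notation W s := (clark_vec v (zeta s)).
Local Notation da p := (sqrt_deriv u (eta p)).
Local Notation db s := (sqrt_deriv v (zeta s)).

Let eta1 p : `|eta p| = 1. Proof. exact: clark_circle clark1 p. Qed.
Let zeta1 s : `|zeta s| = 1. Proof. exact: clark_circle clark2 s. Qed.
Let da0 p : da p != 0. Proof. exact: sqrt_deriv_neq0 a_lt1 clark1 p. Qed.
Let db0 s : db s != 0. Proof. exact: sqrt_deriv_neq0 b_lt1 clark2 s. Qed.
Let Lk p : L2 (k p). Proof. exact: model_L2 (bkernel_model a_lt1 clark1 p). Qed.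
Let Ll s : L2 (l s). Proof. exact: model_L2 (bkernel_model b_lt1 clark2 s). Qed.
Let LV p : L2 (V p). Proof. exact: L2_clark a_lt1 clark1 p. Qed.
Let LW s : L2 (W s). Proof. exact: L2_clark b_lt1 clark2 s. Qed.

Lemma matrix_entry p s : r s p = inner (A (V p)) (W s).
Proof.
have KA := linear_op_maps hA (model_clark a_lt1 clark1 p).
rewrite (inner_aeq (model_L2 KA) (L2_clark_sum b_lt1 clark2 (fun s => r s p))
  (LW s) (LW s) (hr p) (aeq_refl _)).
by rewrite (inner_clark_sum b_lt1 clark2).
Qed.

(** The factors remove the norms of the kernels and the coefficient of their
    product in [bkernel_split]. *)
Definition entries_separate := exists x y, forall p s,
  r s p * (da p * db s) / eta p * (eta p - zeta s) = x p - y s.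

Lemma clark_inner_scale phi p s : L2 (fun z => phi z * V p z) ->
  da p * db s * inner (fun z => phi z * V p z) (W s) =
  circle_mean (fun z => phi z * (k p z * (l s z)^*)).
Proof.
move=> LpV; have I1 := cintegrableM LpV (L2J (LW s)).
rewrite /inner -mean_scale //; apply: mean_eq_circle => t.
rewrite !(clark_vecE a_lt1 clark1) !(clark_vecE b_lt1 clark2).
rewrite rmorphM fmorphV /= (sqrt_derivJ b_lt1 clark2).
have dp := da0 p; have ds := db0 s.
move: (k p _) (l s _)^* (phi _) (da p) (db s) dp ds => x y w d1 d2 dp ds.
by field; rewrite dp ds.
Qed.

(** Integrate the symbol times [bkernel_split]. *)
Lemma separate_of_atto : in_atto u v A -> entries_separate.
Proof.
move=> [phi [Lphi hphi _]].
have ort p := hphi _ (model_clark a_lt1 clark1 p).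
have LpV p : L2 (fun z => phi z * V p z) by case: (ort p).
have rE p s : r s p = inner (fun z => phi z * V p z) (W s).
  have [_ KA h] := ort p.
  have := h _ (model_clark b_lt1 clark2 s).
  rewrite (innerBl (LpV p) (model_L2 KA) (LW s)) -matrix_entry => /eqP.
  by rewrite subr_eq0 => /eqP ->.
pose a0 := clark_val a lambda1; pose b0 := clark_val b lambda2.
pose F p z := (eta p)^* * z * (phi z * k p z) * (1 - b0 * (v z)^*).
pose G s z := phi z * (1 - a0^* * u z) * (l s z)^*.
exists (fun p => circle_mean (F p)), (fun s => - circle_mean (G s)) => p s.
have LF : L2 (F p).
  have Lpk : L2 (fun z => phi z * k p z).
    have := L2Z (da p) (LpV p); congr L2; apply/funext => z.
    by rewrite (clark_vecE a_lt1 clark1) mulrCA [da p * _]mulrA divff // mul1r.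
  have Lzpk : L2 (fun z => (eta p)^* * (z * (phi z * k p z))).
    by apply: L2Z; apply: L2_mulb (1) (mble_id R) _ Lpk => t; rewrite nrm2_cis.
  have := L2B Lzpk (L2Z b0 (L2_blaschkeJ_mul b_lt1 Lzpk)).
  by congr L2; apply/funext => z; rewrite /F; ring.
have IG : cintegrable (G s).
  apply: (cintegrableM _ (L2J (Ll s))).
  have := L2B Lphi (L2Z a0^* (L2_blaschke_mul a_lt1 Lphi)).
  by congr L2; apply/funext => z; ring.
have IP : cintegrable (fun z => phi z * (k p z * (l s z)^*)).
  have := cintegrableM (L2Z (da p) (LpV p)) (L2J (Ll s)).
  congr cintegrable; apply/funext => z.
  by rewrite (clark_vecE a_lt1 clark1) mulrCA [da p * _]mulrA divff // mul1r mulrA.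
have e1 : r s p * (da p * db s) = circle_mean (fun z => phi z * (k p z * (l s z)^*)).
  by rewrite -(clark_inner_scale s (LpV p)) -rE mulrC.
have ee : (eta p)^-1 = (eta p)^*.
  apply: (mulfI (norm1_neq0 (eta1 p))).
  by rewrite (norm1_mulJ (eta1 p)) divff ?norm1_neq0.
rewrite e1 opprK ee -mulrA mulrC [(eta p)^* * _]mulrC -mean_scale //.
rewrite -[circle_mean (F p)]mul1r -(mean_lin 1 (cintegrable_L2 LF) IG).
apply: (mean_aeq (cintegrableZ _ IP)
  (cintegrableD (cintegrableZ 1 (cintegrable_L2 LF)) IG)).
apply: (@aeq_off _ [:: eta p; zeta s]) => t; rewrite !inE negb_or => /andP[ne1 ne2].
have sp := bkernel_split u v (eta1 p) (zeta1 s) (norm_cis t) ne1 ne2.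
rewrite (clark_valE clark1) (clark_valE clark2) -/a0 -/b0 in sp.
by rewrite /F /G [LHS]mulrCA sp; ring.
Qed.

Lemma inner_hornerX (P : {poly C}) j : inner (horner P) (fun z => z ^+ j) = P`_j.
Proof.
transitivity (inner (fun z => \sum_(i < size P) P`_i * z ^+ i) (fun z => z ^+ j)).
  by apply: mean_eq_circle => t; rewrite horner_coef.
rewrite inner_suml; [|by move=> i; exact: L2X|exact: L2X].
transitivity (\sum_(i < size P) if i == j :> nat then P`_i else 0).
  by apply: eq_bigr => i _; rewrite innerX; case: eqP; rewrite ?mulr1 ?mulr0.
rewrite -big_mkcond /=.
have [jP|Pj] := ltnP j (size P).
  by rewrite (big_pred1 (Ordinal jP)) // => i; rewrite -val_eqE.
rewrite big1 ?nth_default // => i /eqP e.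
by have := ltn_ord i; rewrite e ltnNge Pj.
Qed.

Lemma L2_horner_mul (P : {poly C}) f : L2 f -> L2 (fun z => P.[z] * f z).
Proof.
move=> Lf; elim/poly_ind: P => [|P c IH].
  by under eq_fun do rewrite horner0 mul0r; exact: L2_cst.
have zf : L2 (fun z => z * (P.[z] * f z)).
  by apply: L2_mulb (1) (mble_id R) _ IH => t; rewrite nrm2_cis.
have := L2D zf (L2Z c Lf); congr L2; apply/funext => z.
by rewrite hornerMXaddC; ring.
Qed.

Lemma L2_XJ_mul j f : L2 f -> L2 (fun z => (z ^+ j)^* * f z).
Proof.
apply: L2_mulb; first exact/mbleJ/mbleX.
by move=> t; rewrite nrm2J nrm2X nrm2_cis expr1n.
Qed.

(** Each kernel is a Lagrange polynomial over [bden], and by [bkernel_conj] the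
    conjugate of a kernel is z times one over [bnum]. *)
Lemma kernel_product p s t : cis t != eta p -> cis t != zeta s ->
  (bden a).[cis t] * (bnum b).[cis t] * (k p (cis t) * (l s (cis t))^*) =
  eta p * (lead_coef (clark_poly a lambda1) * clark_val b lambda2 *
    lead_coef (clark_poly b lambda2)) *
  (cis t * (others eta p * others zeta s).[cis t]).
Proof.
move=> ne1 ne2; have z1 := norm_cis t; have z1' : `|cis t| <= 1 by rewrite z1.
have da1 := bden_neq0 a_lt1 z1'; have db1 := bden_neq0 b_lt1 z1'.
have zz := norm1_mulJ (zeta1 s).
have e1 : k p (cis t) * (bden a).[cis t] =
    kcoef a lambda1 eta p * (others eta p).[cis t].
  by rewrite (bkernelE a_lt1 clark1 z1' ne1) /kfun divfK.
have e2 : l s (cis t) * (bden b).[cis t] =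
    kcoef b lambda2 zeta s * (others zeta s).[cis t].
  by rewrite (bkernelE b_lt1 clark2 z1' ne2) /kfun divfK.
have e3 : (l s (cis t))^* * (bnum b).[cis t] =
    clark_val b lambda2 * (zeta s)^* * cis t * (l s (cis t) * (bden b).[cis t]).
  rewrite [RHS]mulrA -(bkernelJ b_lt1 clark2) [v _]blaschkeE.
  by rewrite -[RHS]mulrA divfK.
rewrite hornerM [LHS](_ : _ = (k p (cis t) * (bden a).[cis t]) *
  ((l s (cis t))^* * (bnum b).[cis t])); last by ring.
rewrite e1 e3 e2 /kcoef.
move: (lead_coef _) (lead_coef _) (clark_val _ _) (others _ _).[_] (others _ _).[_].
move=> c1 c2 b0 x1 x2.
rewrite [LHS](_ : _ = zeta s * (zeta s)^* * (eta p * (c1 * b0 * c2) * (cis t * (x1 * x2)))).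
  by rewrite zz mul1r; ring.
by ring.
Qed.

Lemma op_expansion f : model_space u f ->
  aeq (A f) (fun z => \sum_s (\sum_p inner f (V p) * r s p) * W s z).
Proof.
move=> Kf; have KV p := model_clark a_lt1 clark1 p.
have Ks := model_sum a_lt1 (index_enum 'I_m.+1) (fun p => inner f (V p)) KV.
apply: aeq_trans (linear_op_aeq hA Kf Ks (clark_expansion a_lt1 clark1 Kf)) _.
apply: aeq_trans (linear_op_sum a_lt1 _ (fun p => inner f (V p)) hA KV) _.
apply: (@aeq_trans _ _ (fun z => \sum_p inner f (V p) * \sum_s r s p * W s z)).
  apply: aeq_sum => p; exact: (@aeq_op1 _ (fun _ x => inner f (V p) * x) _ _ (hr p)).
apply: aeq_circle => t.
under eq_bigr do rewrite mulr_sumr; rewrite exchange_big /=.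
by apply: eq_bigr => s _; rewrite mulr_suml; apply: eq_bigr => p _; rewrite mulrA.
Qed.

Lemma inner_op f s : model_space u f ->
  inner (A f) (W s) = \sum_p inner f (V p) * r s p.
Proof.
move=> Kf; have KA := linear_op_maps hA Kf.
rewrite (inner_aeq (model_L2 KA) (L2_clark_sum b_lt1 clark2 _) (LW s) (LW s)
  (op_expansion Kf) (aeq_refl _)).
by rewrite (inner_clark_sum b_lt1 clark2).
Qed.

(** Bessel bounds the coefficients of f, hence those of A f, which give its norm
    by orthonormality. *)
Lemma op_bounded : bounded_op (model_space u) A.
Proof.
pose rho s : R := \sum_p Num.sqrt (nrm2 (r s p)).
exists (Num.sqrt (\sum_s rho s ^+ 2)) => f Kf.
have Lf := model_L2 Kf; have KA := linear_op_maps hA Kf.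
have N0 : 0 <= L2norm f by exact: sqrtr_ge0.
have cp p : `|inner f (V p)| <= (L2norm f)%:C%C.
  rewrite -ler_sqr ?nnegrE ?normr_ge0 ?ler0c // L2normE.
  by apply: bessel => //; rewrite (inner_clark a_lt1 clark1) eqxx.
have cs s : `|inner (A f) (W s)| <= (rho s * L2norm f)%:C%C.
  rewrite inner_op //; apply: le_trans (ler_norm_sum _ _ _) _.
  rewrite /rho mulr_suml rmorph_sum; apply: ler_sum => p _ /=.
  rewrite normrM [leLHS]mulrC rmorphM /= -normCE.
  exact: (ler_wpM2l (normr_ge0 _) (cp p)).
have S0 : 0 <= \sum_s rho s ^+ 2 by apply: sumr_ge0 => s _; exact: sqr_ge0.
rewrite -ler_sqr ?nnegrE ?mulr_ge0 ?sqrtr_ge0 // exprMn (sqr_sqrtr S0).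
rewrite -lecR rmorphXn /= L2normE.
have -> : inner (A f) (A f) = \sum_s inner (A f) (W s) * (inner (A f) (W s))^*.
  have e := clark_expansion b_lt1 clark2 KA.
  have Ls := L2_clark_sum b_lt1 clark2 (fun s => inner (A f) (W s)).
  rewrite (inner_aeq (model_L2 KA) Ls (model_L2 KA) Ls e e).
  exact: (norm_clark_sum b_lt1 clark2).
rewrite mulr_suml rmorph_sum; apply: ler_sum => s _ /=.
rewrite -normCK -exprMn rmorphXn /= ler_sqr ?nnegrE ?normr_ge0 ?cs //.
by apply: le_trans (cs s); exact: normr_ge0.
Qed.

(** Orthogonality of phi f - A f to the model space only involves scalar products
    with Clark vectors, and boundedness is automatic in finite dimension. *)
Lemma atto_of_matrix phi : (forall f, L2 f -> L2 (fun z => phi z * f z)) ->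
  (forall p s, inner (fun z => phi z * V p z) (W s) = r s p) -> in_atto u v A.
Proof.
move=> Lphi hphi; exists phi; split; last exact: op_bounded.
  by have := Lphi _ (L2_cst 1); congr L2; apply/funext => z; rewrite mulr1.
move=> f Kf; have Lf := model_L2 Kf; have KA := linear_op_maps hA Kf.
split; [exact: Lphi | exact: KA |] => g Kg.
have Lpf := Lphi _ Lf.
apply: (inner_clark_eq0 b_lt1 clark2 (L2B Lpf (model_L2 KA)) Kg) => s.
rewrite (innerBl Lpf (model_L2 KA) (LW s)) (inner_op s Kf).
have e : aeq (fun z => phi z * f z) (fun z => \sum_p inner f (V p) * (phi z * V p z)).
  apply: ae_imp (clark_expansion a_lt1 clark1 Kf) => t h tA; rewrite {1}h //.
  by rewrite mulr_sumr; apply: eq_bigr => p _; rewrite mulrCA.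
have Ls : L2 (fun z => \sum_p inner f (V p) * (phi z * V p z)).
  by apply: L2_sum => p; apply/L2Z/Lphi.
rewrite (inner_aeq Lpf Ls (LW s) (LW s) e (aeq_refl _)).
rewrite inner_suml; [|by move=> p; exact: Lphi|exact: LW].
by apply/eqP; rewrite subr_eq0; apply/eqP/eq_bigr => p _; rewrite hphi.
Qed.

(** The symbol is a trigonometric polynomial: two factors cancel the denominators
    in [kernel_product], and the mean against the third one, psi, is the
    functional of [moment_functional]. *)
Lemma atto_of_separate : entries_separate -> in_atto u v A.
Proof.
move=> [x [y xy]].
pose T s p := r s p * (da p * db s) / eta p.
have [L Llin LT] := moment_functional (clark_inj clark1) (clark_inj clark2)
  (t := T) (fun s p => xy p s).
pose N := (m + n).+1.
pose c := lead_coef (clark_poly a lambda1) * clark_val b lambda2 *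
    lead_coef (clark_poly b lambda2).
have c0 : c != 0.
  apply: mulf_neq0; last exact: clark_lead_neq0.
  apply: mulf_neq0; first exact: clark_lead_neq0.
  exact: norm1_neq0 (clark_val_norm1 b_lt1 clark2).
pose psi z := \sum_(j < N) L 'X^j * (z ^+ j.+1)^*.
pose phi z := c^-1 * ((bden a).[z] * ((bnum b).[z] * psi z)).
have Lpsi f : L2 f -> L2 (fun z => psi z * f z).
  move=> Lf; have LS : L2 (fun z => \sum_(j < N) L 'X^j * ((z ^+ j.+1)^* * f z)).
    by apply: L2_sum => j; apply/L2Z/L2_XJ_mul.
  move: LS; congr L2; apply/funext => z; rewrite /psi mulr_suml.
  by apply: eq_bigr => j _; rewrite mulrA.
have Lphi f : L2 f -> L2 (fun z => phi z * f z).
  move=> Lf; have := L2Z c^-1 (L2_horner_mul (bden a) (L2_horner_mul (bnum b) (Lpsi f Lf))).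
  by congr L2; apply/funext => z; rewrite /phi; ring.
have L0 : L 0 = 0.
  by have := Llin (-1) 0 0; rewrite scaler0 addr0 mulN1r addNr.
have Lsum (q : nat -> C) M :
    L (\sum_(j < M) q j *: 'X^j) = \sum_(j < M) q j * L 'X^j.
  elim: M => [|M IH]; first by rewrite !big_ord0.
  by rewrite !big_ord_recr /= addrC Llin IH addrC.
have LzP (P : {poly C}) j : L2 (fun z => (z ^+ j.+1)^* * (z * P.[z])).
  by apply: L2_XJ_mul; apply: L2_mulb (1) (mble_id R) _ (L2_horner P) => t; rewrite nrm2_cis.
have mean_psi (P : {poly C}) : (size P <= N)%N ->
    circle_mean (fun z => psi z * (z * P.[z])) = L P.
  move=> sP; have -> : L P = \sum_(j < N) P`_j * L 'X^j.
    rewrite -Lsum; congr L; apply/polyP => i; rewrite coef_sum.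
    under eq_bigr do rewrite coefZ coefXn mulr_natr mulrb eq_sym.
    rewrite -big_mkcond /=; have [iN|Ni] := ltnP i N.
      by rewrite (big_pred1 (Ordinal iN)) // => j; rewrite -val_eqE.
    rewrite big1 ?nth_default ?(leq_trans sP) // => j /eqP e.
    by have := ltn_ord j; rewrite e ltnNge Ni.
  transitivity (circle_mean (fun z => \sum_(j < N) L 'X^j * ((z ^+ j.+1)^* * (z * P.[z])))).
    apply: mean_eq_circle => t; rewrite /psi mulr_suml.
    by apply: eq_bigr => j _; rewrite [RHS]mulrA.
  rewrite mean_sum; last by move=> j; apply: L2Z; exact: LzP.
  apply: eq_bigr => j _; rewrite meanZ; last exact: LzP.
  rewrite mulrC; congr (_ * _).
  have -> : P`_j = ('X * P)`_j.+1 by rewrite coefXM.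
  rewrite -inner_hornerX; apply: mean_eq_circle => t.
  by rewrite hornerM hornerX mulrC.
apply: (atto_of_matrix Lphi) => p s.
have h := clark_inner_scale s (Lphi _ (LV p)).
have dd : da p * db s != 0 by rewrite mulf_neq0.
apply: (mulfI dd); rewrite h.
pose Q := others eta p * others zeta s.
have Lzq : L2 (fun z => psi z * (z * Q.[z])).
  by apply: Lpsi; apply: L2_mulb (1) (mble_id R) _ (L2_horner Q) => t; rewrite nrm2_cis.
transitivity (circle_mean (fun z => eta p * (psi z * (z * Q.[z])))).
  apply: mean_aeq.
  - have := cintegrableM (Lphi _ (Lk p)) (L2J (Ll s)).
    by congr cintegrable; apply/funext => z; rewrite mulrA.
  - exact/cintegrable_L2/L2Z.
  apply: (@aeq_off _ [:: eta p; zeta s]) => t; rewrite !inE negb_or => /andP[ne1 ne2].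
  rewrite /phi [LHS](_ : _ = c^-1 * psi (cis t) * ((bden a).[cis t] * (bnum b).[cis t] *
    (k p (cis t) * (l s (cis t))^*))); last by ring.
  rewrite (kernel_product ne1 ne2) -/c -/Q.
  by move: (psi _) Q.[_] => x1 x2; field.
rewrite meanZ // mean_psi; last first.
  rewrite size_monicM ?monic_neq0 ?monic_others //.
  by rewrite !size_others addnS.
by rewrite /Q LT /T mulrCA divff ?norm1_neq0 // mulr1 mulrC.
Qed.

End TwoClarkBases.

Local Close Scope classical_set_scope.

(** * The entrywise formulas *)

Section EntryFormulas.
Variable K : fieldType.
Variables (m n l : nat).
Implicit Types (p : 'I_m.+1) (s : 'I_n.+1).

(** Normalize x and y by their values at the first indices. *)
Lemma separateP (U : 'I_n.+1 -> 'I_m.+1 -> K) :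
  (exists x y, forall p s, U s p = x p - y s) <->
  (forall s p, U s p = U s ord0 - U ord0 ord0 + U ord0 p).
Proof.
split=> [[x [y xy]] s p|h]; first by rewrite !xy; ring.
exists (U ord0), (fun s => U ord0 ord0 - U s ord0) => p s.
by rewrite h; ring.
Qed.

Variables (eta : 'I_m.+1 -> K) (zeta : 'I_n.+1 -> K).
Variables (da : 'I_m.+1 -> K) (db : 'I_n.+1 -> K) (r : 'M[K]_(n.+1, m.+1)).
Hypotheses (eta0 : forall p, eta p != 0) (da0 : forall p, da p != 0)
  (db0 : forall s, db s != 0).
Hypothesis common : forall p s, eta p = zeta s <-> (p = s :> nat /\ (p < l)%N).

Let U s p := r s p * (da p * db s) / eta p * (eta p - zeta s).
Let D s p := eta p / (da p * db s) / (eta p - zeta s).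

Let rU s p : eta p != zeta s -> r s p = U s p * D s p.
Proof.
move=> ne; have h : eta p - zeta s != 0 by rewrite subr_eq0.
rewrite /U /D; have := eta0 p; have := da0 p; have := db0 s.
by move=> h1 h2 h3; field; rewrite h1 h2 h3 h.
Qed.

Let D0 s p : eta p != zeta s -> D s p != 0.
Proof.
move=> ne; have h : eta p - zeta s != 0 by rewrite subr_eq0.
by rewrite /D !mulf_neq0 ?invr_eq0 ?mulf_neq0.
Qed.

Let U0 s p : eta p = zeta s -> U s p = 0.
Proof. by move=> e; rewrite /U e subrr mulr0. Qed.

Let scaled s p (x y : K) : eta p != zeta s -> x = y * D s p ->
  (r s p = x <-> U s p = y).
Proof.
move=> ne ->; rewrite (rU ne); split=> [|->//].
exact: (mulIf (D0 ne)).
Qed.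

Lemma entries_disjoint : l = 0%N ->
  (forall s p, U s p = U s ord0 - U ord0 ord0 + U ord0 p) <->
  (forall p s, r s p =
         da ord0 / da p * (eta p / eta ord0)
           * ((eta ord0 - zeta s) / (eta p - zeta s)) * r s ord0
       + (da ord0 * db ord0) / (da p * db s) * (eta p / eta ord0)
           * ((zeta ord0 - eta ord0) / (eta p - zeta s)) * r ord0 ord0
       + db ord0 / db s
           * ((eta p - zeta ord0) / (eta p - zeta s)) * r ord0 p).
Proof.
move=> l0; have ne p s : eta p != zeta s.
  by apply/eqP => /common[_]; rewrite l0.
suff h p s : r s p =
         da ord0 / da p * (eta p / eta ord0)
           * ((eta ord0 - zeta s) / (eta p - zeta s)) * r s ord0
       + (da ord0 * db ord0) / (da p * db s) * (eta p / eta ord0)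
           * ((zeta ord0 - eta ord0) / (eta p - zeta s)) * r ord0 ord0
       + db ord0 / db s
           * ((eta p - zeta ord0) / (eta p - zeta s)) * r ord0 p <->
    U s p = U s ord0 - U ord0 ord0 + U ord0 p.
  by split=> H; [move=> p s; exact/h/H | move=> s p; exact/h/H].
apply: (scaled (ne p s)); rewrite /U /D.
have h : eta p - zeta s != 0 by rewrite subr_eq0.
have := eta0 p; have := eta0 ord0; have := da0 p; have := da0 ord0.
have := db0 s; have := db0 ord0 => h1 h2 h3 h4 h5 h6.
by field; rewrite h h2 h4 h5 h6.
Qed.

Lemma entries_common : (0 < l)%N -> (l <= m.+1)%N -> (l <= n.+1)%N ->
  (forall s p, U s p = U s ord0 - U ord0 ord0 + U ord0 p) <->
  (forall (p s' : 'I_m.+1) s, s' = s :> nat -> (s < l)%N -> s' != p ->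
       r s p =
         (da s' * db ord0) / (da p * db s) * (eta p / eta s')
           * ((eta ord0 - zeta s) / (eta p - zeta s)) * r ord0 s'
       + db ord0 / db s
           * ((eta p - zeta ord0) / (eta p - zeta s)) * r ord0 p) /\
  (forall p s, (l <= s)%N ->
       r s p =
         da ord0 / da p * (eta p / eta ord0)
           * ((eta ord0 - zeta s) / (eta p - zeta s)) * r s ord0
       + db ord0 / db s
           * ((eta p - zeta ord0) / (eta p - zeta s)) * r ord0 p).
Proof.
move=> l0 lm ln.
have e0 : eta ord0 = zeta ord0 by apply/common.
have U00 : U ord0 ord0 = 0 by apply: U0.
have h1 p (s' : 'I_m.+1) s : s' = s :> nat -> (s < l)%N -> s' != p ->
    (r s p = (da s' * db ord0) / (da p * db s) * (eta p / eta s')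
           * ((eta ord0 - zeta s) / (eta p - zeta s)) * r ord0 s'
       + db ord0 / db s
           * ((eta p - zeta ord0) / (eta p - zeta s)) * r ord0 p
     <-> U s p = - U ord0 s' + U ord0 p).
  move=> ss sl s'p.
  have es : eta s' = zeta s by apply/common; rewrite ss.
  have ne : eta p != zeta s.
    apply/eqP => /common[ps _]; move/eqP: s'p; apply; apply: val_inj.
    by rewrite /= ss ps.
  apply: (scaled ne); rewrite /U /D.
  have h : eta p - zeta s != 0 by rewrite subr_eq0.
  have := eta0 p; have := eta0 s'; have := da0 p; have := da0 s'.
  have := db0 s; have := db0 ord0; rewrite e0 -es in h *.
  by move=> g1 g2 g3 g4 g5 g6; field; rewrite h g2 g4 g5 g6.
have h2 p s : (l <= s)%N ->
    (r s p = da ord0 / da p * (eta p / eta ord0)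
           * ((eta ord0 - zeta s) / (eta p - zeta s)) * r s ord0
       + db ord0 / db s
           * ((eta p - zeta ord0) / (eta p - zeta s)) * r ord0 p
     <-> U s p = U s ord0 + U ord0 p).
  move=> ls; have ne : eta p != zeta s.
    by apply/eqP => /common[ps]; rewrite ps ltnNge ls.
  apply: (scaled ne); rewrite /U /D.
  have h : eta p - zeta s != 0 by rewrite subr_eq0.
  have := eta0 p; have := eta0 ord0; have := da0 p; have := da0 ord0.
  have := db0 s; have := db0 ord0 => g1 g2 g3 g4 g5 g6.
  by field; rewrite h g2 g4 g5 g6.
split=> [H|[H1 H2]].
  split=> [p s' s ss sl s'p|p s ls]; last first.
    by apply/(h2 _ _ ls); rewrite H U00 subr0.
  apply/(h1 _ _ _ ss sl s'p); rewrite H U00 subr0; congr (_ + _).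
  have es : eta s' = zeta s by apply/common; rewrite ss.
  have := H s s'; rewrite (U0 es) U00 subr0 => /eqP.
  by rewrite eq_sym addr_eq0 => /eqP.
move=> s p; rewrite U00 subr0; have [ls|sl] := leqP l s.
  exact/(h2 _ _ ls)/H2.
pose s' : 'I_m.+1 := Ordinal (leq_trans sl lm).
have ss : s' = s :> nat by [].
have es : eta s' = zeta s by apply/common.
have Us0 : U s ord0 = - U ord0 s'.
  have [s0|s0] := eqVneq s' ord0.
    have -> : s = ord0 by apply: val_inj; rewrite /= -ss s0.
    by rewrite s0 U00 oppr0.
  have /h1 := H1 ord0 s' s ss sl s0; rewrite U00 addr0; exact.
rewrite Us0; have [<-|s'p] := eqVneq s' p; last exact/(h1 _ _ _ ss sl s'p)/H1.
by rewrite addNr; apply: U0.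
Qed.

End EntryFormulas.

(** The l indices below l already give l common points, so there are no
    others. *)
Lemma common_points (K : eqType) (m n l : nat) (eta : 'I_m.+1 -> K)
    (zeta : 'I_n.+1 -> K) : injective eta -> injective zeta ->
  #|[set p | eta p \in codom zeta]| = l ->
  (forall (p : 'I_m.+1) (s : 'I_n.+1), p = s :> nat -> (p < l)%N -> eta p = zeta s) ->
  [/\ (l <= m.+1)%N, (l <= n.+1)%N &
      forall p s, eta p = zeta s <-> (p = s :> nat /\ (p < l)%N)].
Proof.
move=> ei zi; set S := [set p | _] => cS hc.
have lm : (l <= m.+1)%N by rewrite -cS -[X in (_ <= X)%N]card_ord max_card.
have ln : (l <= n.+1)%N.
  have -> : l = size [seq eta p | p <- enum S] by rewrite size_map -cardE.
  rewrite -[X in (_ <= X)%N]card_ord -(size_codom zeta).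
  apply: uniq_leq_size; first by rewrite map_inj_uniq ?enum_uniq.
  by move=> _ /mapP[p pS ->]; move: pS; rewrite mem_enum inE.
split=> // p s; split=> [e|[]]; last exact: hc.
have TS : [set p : 'I_m.+1 | (p < l)%N] = S.
  apply/eqP; rewrite eqEcard; apply/andP; split.
    apply/fintype.subsetP => q; rewrite !inE => ql.
    by rewrite (hc q (Ordinal (leq_trans ql ln))) ?codom_f.
  rewrite cS cardE -[leqLHS](size_enum_ord l) -(size_map (widen_ord lm)).
  apply: uniq_leq_size.
    by rewrite map_inj_uniq ?enum_uniq // => i j /(congr1 val) /= /val_inj.
  by move=> _ /mapP[i _ ->]; rewrite mem_enum inE; exact: (ltn_ord i).
have pl : (p < l)%N by have : p \in S; [rewrite inE e codom_f | rewrite -TS inE].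
split=> //; have e2 := hc p (Ordinal (leq_trans pl ln)) erefl pl.
by rewrite (zi _ _ (etrans (esym e) e2)).
Qed.

Theorem theorem3p4 (R : realType) (m n l : nat)
    (a : 'I_m.+1 -> R[i]) (b : 'I_n.+1 -> R[i])
    (ha : forall i, `|a i| < 1) (hb : forall j, `|b j| < 1)
    (lambda1 lambda2 : R[i])
    (hlambda1 : `|lambda1| = 1) (hlambda2 : `|lambda2| = 1)
    (eta : 'I_m.+1 -> R[i]) (zeta : 'I_n.+1 -> R[i])
    (heta : clark_points (blaschke a) lambda1 eta)
    (hzeta : clark_points (blaschke b) lambda2 zeta)
    (hcard : #|[set p | eta p \in codom zeta]| = l)
    (hcommon : forall (p : 'I_m.+1) (s : 'I_n.+1),
       p = s :> nat -> (p < l)%N -> eta p = zeta s)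
    (A : (R[i] -> R[i]) -> (R[i] -> R[i]))
    (hA : linear_op (model_space (blaschke a)) (model_space (blaschke b)) A)
    (r : 'M[R[i]]_(n.+1, m.+1))
    (hr : is_matrix_of A (fun p => clark_vec (blaschke a) (eta p))
            (fun s => clark_vec (blaschke b) (zeta s)) r) :
  let da p := sqrt_deriv (blaschke a) (eta p) in
  let db s := sqrt_deriv (blaschke b) (zeta s) in
  (l = 0%N ->
    (in_atto (blaschke a) (blaschke b) A <->
     forall p s,
       r s p =
         da ord0 / da p * (eta p / eta ord0)
           * ((eta ord0 - zeta s) / (eta p - zeta s)) * r s ord0
       + (da ord0 * db ord0) / (da p * db s) * (eta p / eta ord0)
           * ((zeta ord0 - eta ord0) / (eta p - zeta s)) * r ord0 ord0
       + db ord0 / db s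
           * ((eta p - zeta ord0) / (eta p - zeta s)) * r ord0 p)) /\
  ((0 < l)%N ->
    (in_atto (blaschke a) (blaschke b) A <->
     (* s' is the index s, s < l, seen as a column index *)
     (forall (p s' : 'I_m.+1) (s : 'I_n.+1),
       s' = s :> nat -> (s < l)%N -> s' != p ->
       r s p =
         (da s' * db ord0) / (da p * db s) * (eta p / eta s')
           * ((eta ord0 - zeta s) / (eta p - zeta s)) * r ord0 s'
       + db ord0 / db s
           * ((eta p - zeta ord0) / (eta p - zeta s)) * r ord0 p) /\
     (forall (p : 'I_m.+1) (s : 'I_n.+1), (l <= s)%N ->
       r s p =
         da ord0 / da p * (eta p / eta ord0)
           * ((eta ord0 - zeta s) / (eta p - zeta s)) * r s ord0
       + db ord0 / db s
           * ((eta p - zeta ord0) / (eta p - zeta s)) * r ord0 p))).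
Proof.
move=> da db.
have [lm ln common] := common_points (clark_inj heta) (clark_inj hzeta) hcard hcommon.
have eta0 p : eta p != 0 by exact: norm1_neq0 (clark_circle heta p).
have da0 p : da p != 0 by exact: sqrt_deriv_neq0 ha heta p.
have db0 s : db s != 0 by exact: sqrt_deriv_neq0 hb hzeta s.
have attoE : in_atto (blaschke a) (blaschke b) A <->
    forall s p, r s p * (da p * db s) / eta p * (eta p - zeta s) =
      r s ord0 * (da ord0 * db s) / eta ord0 * (eta ord0 - zeta s)
      - r ord0 ord0 * (da ord0 * db ord0) / eta ord0 * (eta ord0 - zeta ord0)
      + r ord0 p * (da p * db ord0) / eta p * (eta p - zeta ord0).
  apply: (iff_trans _ (separateP (fun s p =>
    r s p * (da p * db s) / eta p * (eta p - zeta s)))).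
  split; first by have := separate_of_atto ha hb heta hzeta hA hr.
  exact: (atto_of_separate ha hb heta hzeta hA hr).
split=> l0; apply: (iff_trans attoE).
- exact: (entries_disjoint r eta0 da0 db0 common l0).
- exact: (entries_common r eta0 da0 db0 common l0 lm ln).
Qed.
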